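(* Fix a cut and project scheme $(\mathbb{R}^n, \mathbb{R}^m, \mathcal{L})$ as described in the context. Let $W, W' \subset \mathbb{R}^m$ be windows (compact sets with $W=\overline{W^\circ}$, $W'=\overline{W'^\circ}$, non-empty interior, and boundaries of Lebesgue measure $0$), and let $\varLambda = t + \curlywedge(W)$ and $\varLambda' = t' + \curlywedge(W')$ for some $t,t'\in\mathbb{R}^n$ be the corresponding regular model sets. Then $\varLambda$ and $\varLambda'$ are homometric if and only if $W$ and $W'$ have the same covariogram, i.e. $g^{}_{W}(y) = g^{}_{W'}(y)$ for all $y \in \mathbb{R}^m$.
   Context: A cut and project scheme consists of $\mathbb{R}^n$ (direct space), $\mathbb{R}^m$ (internal space), the canonical projections $\pi:\mathbb{R}^n\times\mathbb{R}^m\to\mathbb{R}^n$ and $\pi_{\mathrm{int}}:\mathbb{R}^n\times\mathbb{R}^m\to\mathbb{R}^m$, and a lattice $\mathcal{L}\subset\mathbb{R}^{n+m}$ such that $\pi|_{\mathcal{L}}$ is injective and $L^\star := \pi_{\mathrm{int}}(\mathcal{L})$ is dense in $\mathbb{R}^m$. With $L=\pi(\mathcal{L})$, the $\star$-map $L\to L^\star$ is $x^\star = \pi_{\mathrm{int}}((\pi|_{\mathcal{L}})^{-1}(x))$. For a window $W\subset\mathbb{R}^m$, $\curlywedge(W) := \{x\in L \mid x^\star\in W\}$; a (regular) model set is $\varLambda = t+\curlywedge(W)$ with $t\in\mathbb{R}^n$ and $W$ compact, $W=\overline{W^\circ}$ with non-empty interior, and $\partial W$ of Lebesgue measure $0$.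 The covariogram of a compact set $K\subset\mathbb{R}^m$ is $g^{}_K(y) = \mathrm{vol}(K\cap(y+K))$. The autocorrelation of a Delone set $\varLambda\subset\mathbb{R}^n$ is the measure $\gamma^{}_\varLambda = \lim_{r\to\infty} \frac{1}{\mathrm{vol}(B_r)} \delta_{\varLambda\cap B_r} * \delta_{-\varLambda\cap B_r}$ (vague limit), where $B_r$ is the open ball of radius $r$ about $0$ and $\delta_S=\sum_{x\in S}\delta_x$; for model sets this limit exists (and is independent of the averaging van Hove sequence). Two Delone sets are called homometric if they have the same autocorrelation measure. *)

(* Defs.v *)
(* R^k is modelled as 'rV[R]_k,
   and R^(n+m) = R^n x R^m via lsubmx / rsubmx. *)
From HB Require Import structures.
From mathcomp Require Import all_boot all_order all_algebra.
From mathcomp Require Import all_classical all_reals all_analysis.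
Set Implicit Arguments. Unset Strict Implicit. Unset Printing Implicit Defensive.
Import Order.TTheory GRing.Theory Num.Theory.
Import numFieldNormedType.Exports.
Local Open Scope classical_set_scope.
Local Open Scope ring_scope.

Section Defs.
Variable R : realType.

Definition box (k : nat) (a b : 'rV[R]_k) : set 'rV[R]_k :=
  [set x | forall i : 'I_k, a ord0 i <= x ord0 i /\ x ord0 i < b ord0 i].

Definition box_vol (k : nat) (a b : 'rV[R]_k) : R :=
  \prod_(i < k) Num.max 0 (b ord0 i - a ord0 i).

(* Lebesgue outer measure on R^k: infimum of the total volumes of countable
   covers by boxes.  On Lebesgue measurable sets (compact sets, ...) this is
   the Lebesgue measure vol. *)
Definition leb_vol (k : nat) (A : set 'rV[R]_k) : \bar R :=
  ereal_inf [set (\sum_(0 <= j <oo) (box_vol (ab.1 j) (ab.2 j))%:E)%E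
            | ab in [set ab : (nat -> 'rV[R]_k) * (nat -> 'rV[R]_k) |
                     A `<=` \bigcup_j box (ab.1 j) (ab.2 j)]].

Definition lattice (n m : nat) (B : 'M[R]_(n + m)) : set 'rV[R]_(n + m) :=
  [set map_mx (fun k : int => k%:~R) z *m B | z in [set: 'rV[int]_(n + m)]].

(* pi = lsubmx (direct space R^n), pi_int = rsubmx (internal space R^m) *)
Definition cut_project_scheme (n m : nat) (B : 'M[R]_(n + m)) : Prop :=
  [/\ B \in unitmx,
      (forall x y, lattice B x -> lattice B y -> lsubmx x = lsubmx y -> x = y)
    & dense [set rsubmx z | z in lattice B]].

Definition window (m : nat) (W : set 'rV[R]_m) : Prop :=
  [/\ compact W, closure (interior W) = W, interior W !=set0
    & leb_vol (closure W `\` interior W) = 0%E].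

(* t + curlywedge(W) = { t + x | x in L, x^* in W } where x = pi z, x^* = pi_int z *)
Definition model_set (n m : nat) (B : 'M[R]_(n + m)) (t : 'rV[R]_n)
  (W : set 'rV[R]_m) : set 'rV[R]_n :=
  [set t + lsubmx z | z in [set z | lattice B z /\ W (rsubmx z)]].

Definition covariogram (m : nat) (K : set 'rV[R]_m) (y : 'rV[R]_m) : \bar R :=
  leb_vol (K `&` [set y + x | x in K]).

Definition eball (n : nat) (r : R) : set 'rV[R]_n :=
  [set x | Num.sqrt (\sum_(i < n) x ord0 i ^+ 2) < r].

(* (1/vol(B_r)) (delta_{Lam /\ B_r} * delta_{-Lam /\ B_r}) tested against f *)
Definition autocorr_approx (n : nat) (Lam : set 'rV[R]_n)
  (f : 'rV[R]_n -> R) (r : R) : R :=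
  (\sum_(x \in Lam `&` @eball n r)
     \sum_(y \in [set - z | z in Lam] `&` @eball n r) f (x + y))
  / fine (leb_vol (@eball n r)).

Definition Cc (n : nat) (f : 'rV[R]_n -> R) : Prop :=
  continuous f /\ compact (closure [set x | f x != 0]).

(* Homometric: the vague limits (as r -> oo) of the approximants of both sets
   exist and coincide, i.e. both converge vaguely to one common measure gamma,
   represented by its action on C_c. *)
Definition homometric (n : nat) (Lam Lam' : set 'rV[R]_n) : Prop :=
  exists gamma : ('rV[R]_n -> R) -> R,
    forall f, Cc f ->
      autocorr_approx Lam f r @[r --> +oo] --> gamma f /\
      autocorr_approx Lam' f r @[r --> +oo] --> gamma f.

End Defs.

(* Main.v *)
Require Import Defs.
From HB Require Import structures.
From mathcomp Require Import all_boot all_order all_algebra finmap.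
From mathcomp Require Import all_classical all_reals all_analysis.
From mathcomp Require Import ring lra.
Set Implicit Arguments. Unset Strict Implicit. Unset Printing Implicit Defensive.
Import Order.TTheory GRing.Theory Num.Theory.
Import numFieldNormedType.Exports.
Local Open Scope classical_set_scope.
Local Open Scope ring_scope.

(** Count lattice points. A cell is the set of lattice points in the product of a
    cube of side s in direct space and a cube of side h in internal space. Since
    the internal projections are dense and the lattice is cocompact, any cell can
    be moved by a lattice vector into any cell that is larger by a bounded amount
    in direct space and by an arbitrarily small amount in internal space. Combined
    with a subdivision argument in the style of Fekete's lemma this gives a constant
    c > 0 such that a cell has about c s^n h^m points, uniformly in its position.
    Packing balls and Jordan measurable sets K by cubes then shows that
    #{z : pi(z) in B_r, pi_int(z) in K} / vol(B_r) tends to c vol(K).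

    Grouping the pairs of points of the model set by their difference w, the
    autocorrelation tested against f tends to c sum_w f(pi(w)) g_W(pi_int(w)), a sum
    with finite support because f has compact support and W - W is bounded. As pi is
    injective, bump functions f isolate the individual values of g_W on the dense
    set L*, and g_W is continuous. *)

(** * Cardinality of finite sets *)

Definition set_card (T : choiceType) (A : set T) : nat := #|` fset_set A|.

Section SetCard.
Variables (T U : choiceType).
Implicit Types (A B X : set T) (Y : U -> set T) (s : seq U).

Lemma subset_set_card A B : finite_set B -> A `<=` B -> (set_card A <= set_card B)%N.
Proof.
move=> fB AB; apply: fsubset_leq_card.
by rewrite -fset_set_sub //; exact: sub_finite_set AB fB.
Qed.

Lemma set_card_image (f : T -> U) A : finite_set A -> set_inj A f ->
  set_card (f @` A) = set_card A.
Proof.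
move=> fA f_inj; rewrite /set_card fset_set_image // card_in_imfset //= => x y.
by rewrite !in_fset_set //; exact: f_inj.
Qed.

Lemma sumr_const_set_card (V : nmodType) (v : V) A :
  \sum_(x <- fset_set A) v = v *+ set_card A.
Proof. by rewrite big_const_seq count_predT iter_addr_0. Qed.

Lemma set_cardU A B : finite_set A -> finite_set B -> [disjoint A & B] ->
  set_card (A `|` B) = (set_card A + set_card B)%N.
Proof.
move=> fA fB /disj_setPS AB0; rewrite /set_card fset_setU // cardfsU -fset_setI //.
by move: AB0; rewrite subset0 => ->; rewrite fset_set0 cardfs0 subn0.
Qed.

Lemma set_cardU_le A B : finite_set A -> finite_set B ->
  (set_card (A `|` B) <= set_card A + set_card B)%N.
Proof. by move=> fA fB; rewrite /set_card fset_setU // cardfsU leq_subr. Qed.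

Lemma set_card_le_cover s Y X : {in s, forall i, finite_set (Y i)} ->
  X `<=` \bigcup_(i in [set` s]) Y i -> (set_card X <= \sum_(i <- s) set_card (Y i))%N.
Proof.
move=> fY; have fsY : finite_set (\bigcup_(i in [set` s]) Y i) by exact: bigcup_finite.
move=> /(subset_set_card fsY)/leq_trans; apply; elim: s fY {fsY} => [_|i s IHs fY].
  by rewrite bigcup_seq !big_nil /set_card fset_set0.
have fY' : {in s, forall j, finite_set (Y j)}.
  by move=> j js; apply: fY; rewrite inE js orbT.
have fi : finite_set (Y i) by apply: fY; rewrite mem_head.
rewrite bigcup_seq !big_cons -bigcup_seq.
apply: leq_trans (set_cardU_le fi _) _; first exact: bigcup_finite.
by rewrite leq_add2l IHs.
Qed.

Lemma set_card_ge_packing s Y X : uniq s -> finite_set X -> trivIset [set` s] Y ->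
  \bigcup_(i in [set` s]) Y i `<=` X -> (\sum_(i <- s) set_card (Y i) <= set_card X)%N.
Proof.
move=> + fX + YX.
have fY i : i \in s -> finite_set (Y i).
  by move=> si; apply: sub_finite_set fX => x Yx; apply: YX; exists i.
move=> s_uniq Y_triv; apply: leq_trans (subset_set_card fX YX).
elim: s s_uniq Y_triv fY {YX} => [|i s IHs] /=.
  by rewrite bigcup_seq !big_nil.
move=> /andP[i_s s_uniq] Y_triv fY; rewrite bigcup_seq !big_cons -bigcup_seq.
have Ys_fin : finite_set (\bigcup_(j in [set` s]) Y j).
  by apply: bigcup_finite => // j js; apply: fY; rewrite inE js orbT.
rewrite set_cardU // ?leq_add2l; last 2 first.
- by apply: fY; rewrite mem_head.
- apply/disj_setPS; rewrite setI_bigcupr => x [j js Yx].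
  have: (Y i `&` Y j) x by []; rewrite (trivIsetP.1 Y_triv i j) //= ?mem_head ?inE ?js ?orbT //.
  by apply: contraNneq i_s => ->.
apply: IHs => // [|j js]; last by apply: fY; rewrite inE js orbT.
by apply: sub_trivIset Y_triv => j js /=; rewrite inE js orbT.
Qed.

End SetCard.

Section RowCard.
Variables (T : choiceType) (k : nat) (F : 'I_k -> set T).
Hypothesis F_fin : forall i, finite_set (F i).

Let rows := [set a : 'rV[T]_k | forall i, F i (a ord0 i)].
Let row_of (g : {dffun forall i, fset_set (F i)}) : 'rV[T]_k := \row_i val (g i).

Let row_of_inj : injective row_of.
Proof.
move=> g g' /rowP gg'; apply/ffunP => i; apply/val_inj.
by have := gg' i; rewrite !mxE.
Qed.

Let rowsE : rows = row_of @` [set: {dffun forall i, fset_set (F i)}].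
Proof.
apply/seteqP; split=> [a Fa|_ [g _ <-] i]; last first.
  by rewrite mxE; apply: set_mem; rewrite -in_fset_set //; exact: valP.
have Fa' i : a ord0 i \in fset_set (F i) by rewrite in_fset_set // inE; exact: Fa.
by exists [ffun i => [` Fa' i]%fset] => //; apply/rowP => i; rewrite mxE ffunE.
Qed.

Lemma finite_set_rV : finite_set rows.
Proof. by rewrite rowsE; apply: finite_image; exact: finite_finset. Qed.

Lemma set_card_rV : set_card rows = (\prod_i set_card (F i))%N.
Proof.
have fT : finite_set [set: {dffun forall i, fset_set (F i)}] by exact: finite_finset.
rewrite rowsE set_card_image //; last by move=> g g' _ _; exact: row_of_inj.
have -> : set_card [set: {dffun forall i, fset_set (F i)}] =
    #|{dffun forall i, fset_set (F i)}|.
  rewrite cardE; apply/perm_size/uniq_perm; rewrite ?fset_uniq ?enum_uniq // => g.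
  by rewrite in_fset_set // mem_enum mem_set.
rewrite card_dep_ffun foldrE big_map big_enum /=; apply: eq_bigr => i _.
by rewrite -cardfE.
Qed.

End RowCard.

Lemma int_itv_image (lo : int) (l : nat) :
  [set z : int | lo <= z < lo + l%:Z] = (fun j : nat => lo + j%:Z) @` `I_l.
Proof.
apply/seteqP; split=> [z /= /andP[loz zlo]|_ [j /= jl <-]]; last first.
  by rewrite lerDl ltrD2l /= ltz_nat jl.
exists `|z - lo|%N; last by rewrite gez0_abs ?subr_ge0 // subrKC.
by rewrite /= -ltz_nat gez0_abs ?subr_ge0 // ltrBlDl.
Qed.

Lemma finite_int_itv (lo : int) (l : nat) : finite_set [set z : int | lo <= z < lo + l%:Z].
Proof. by rewrite int_itv_image; apply: finite_image; exact: finite_II. Qed.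

Lemma set_card_int_itv (lo : int) (l : nat) :
  set_card [set z : int | lo <= z < lo + l%:Z] = l.
Proof.
rewrite int_itv_image set_card_image; last 2 first.
- exact: finite_II.
- by move=> i j _ _ /addrI[].
exact: card_fset_set (card_eqxx _).
Qed.

(** * Row vectors with the supremum norm *)

Section RowVector.
Variables (R : realType) (k : nat).
Implicit Types x a : 'rV[R]_k.

Lemma rV_norm_leP x (e : R) : 0 <= e ->
  reflect (forall i, `|x ord0 i| <= e) (`|x| <= e).
Proof.
move=> e0; rewrite [leLHS]/Num.norm /= mx_normrE.
apply: (iffP (bigmax_leP _ _ _ _)) => [[_ xe] i|xe]; first exact: (xe (ord0, i)).
by split=> // -[i j] _ /=; rewrite (ord1 i).
Qed.

Lemma rV_norm_ltP x (e : R) : 0 < e ->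
  reflect (forall i, `|x ord0 i| < e) (`|x| < e).
Proof.
move=> e0; rewrite [ltLHS]/Num.norm /= mx_normrE.
apply: (iffP (bigmax_ltP _ _ _ _)) => [[_ xe] i|xe]; first exact: (xe (ord0, i)).
by split=> // -[i j] _ /=; rewrite (ord1 i).
Qed.

Lemma coord_norm_le x i : `|x ord0 i| <= `|x|.
Proof. exact: (rV_norm_leP _ (normr_ge0 x) _). Qed.

Lemma cvg_const_mx {T} {F : set_system T} {FF : Filter F} (f : T -> R) (l : R) :
  f t @[t --> F] --> l -> const_mx (f t) @[t --> F] --> (const_mx l : 'rV[R]_k).
Proof.
have const_mxE (c : R) : const_mx c = c *: const_mx 1 :> 'rV[R]_k.
  by rewrite scalemx_const mulr1.
by move=> fl; under eq_cvg do rewrite const_mxE; rewrite const_mxE; exact: cvgZr_tmp.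
Qed.

Lemma cvgD_const_mx0 a : a + const_mx d @[d --> 0^'+] --> a.
Proof.
rewrite -[X in _ --> X]addr0; apply: cvgD; first exact: cvg_cst.
by apply: cvg_const_mx; exact: cvg_within.
Qed.

Lemma cvgB_const_mx0 a : a - const_mx d @[d --> 0^'+] --> a.
Proof.
rewrite -[X in _ --> X]subr0; apply: cvgB; first exact: cvg_cst.
by apply: cvg_const_mx; exact: cvg_within.
Qed.

End RowVector.

Lemma bounded_setP (K : numFieldType) (V : pseudoMetricNormedZmodType K) (A : set V) :
  bounded_set A <-> exists2 M, 0 < M & forall x, A x -> `|x| <= M.
Proof.
split=> [/pinfty_ex_gt0[M M0 AM]|[M M0 AM]]; first by exists M.
exists M; split; first exact: gtr0_real.
by move=> N MN x /AM/le_trans; apply; exact: ltW.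
Qed.

Lemma sub_bounded_set (K : numFieldType) (V : pseudoMetricNormedZmodType K) (A B : set V) :
  A `<=` B -> bounded_set B -> bounded_set A.
Proof.
by move=> AB /bounded_setP[M M0 BM]; apply/bounded_setP; exists M => // x /AB/BM.
Qed.

Lemma bounded_setU (K : numFieldType) (V : pseudoMetricNormedZmodType K) (A B : set V) :
  bounded_set A -> bounded_set B -> bounded_set (A `|` B).
Proof.
move=> /bounded_setP[M M0 AM] /bounded_setP[N N0 BN]; apply/bounded_setP.
exists (M + N); first exact: addr_gt0.
by move=> x [/AM xM|/BN xN]; [rewrite ler_wpDr // ltW|rewrite ler_wpDl // ltW].
Qed.

Section Box.
Variables (R : realType) (k : nat).
Implicit Types a b : 'rV[R]_k.

Lemma box_vol_ge0 a b : 0 <= box_vol a b.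
Proof. by apply: prodr_ge0 => i _; rewrite le_max lexx. Qed.

Lemma box_vol_cube a (h : R) : 0 <= h -> box_vol a (a + const_mx h) = h ^+ k.
Proof.
move=> h0; rewrite /box_vol -[X in _ ^+ X]card_ord -prodr_const.
by apply: eq_bigr => i _; rewrite !mxE [_ + h]addrC addrK; apply/max_idPr.
Qed.

Lemma cvg_box_vol {T} {F : set_system T} {FF : Filter F} (a_ b_ : T -> 'rV[R]_k) a b :
  a_ t @[t --> F] --> a -> b_ t @[t --> F] --> b ->
  box_vol (a_ t) (b_ t) @[t --> F] --> box_vol a b.
Proof.
move=> aF bF; apply: cvg_big => [|i _]; first exact: mul_continuous.
have coordP (c_ : T -> 'rV[R]_k) (c : 'rV[R]_k) : c_ t @[t --> F] --> c ->
    c_ t ord0 i @[t --> F] --> c ord0 i.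
  by move=> cF; apply: (continuous_cvg _ (@coord_continuous R 1 k ord0 i c) cF).
apply: (@continuous_cvg _ _ _ _ _ (fun t => b_ t ord0 i - a_ t ord0 i) (Num.max 0)).
  by apply: (@continuous_max R R (fun=> 0) id); [exact: cvg_cst|exact: cvg_id].
by apply: cvgB; exact: coordP.
Qed.

Lemma bounded_box a b : bounded_set (box a b).
Proof.
apply/bounded_setP; exists (1 + `|a| + `|b|); first by rewrite -addrA ltr_pwDl.
move=> x xab; apply/rV_norm_leP => [|i]; first by rewrite !addr_ge0.
have [ax xb] := xab i; have := coord_norm_le a i; have := coord_norm_le b i.
rewrite !ler_norml => /andP[_ b1] /andP[a1 _].
by have na := normr_ge0 a; have nb := normr_ge0 b; apply/andP; split; lra.
Qed.

End Box.

(** * Counting points of a fine grid *)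

Section IntegerPoints.
Variables (R : realType) (h : R).
Hypothesis h_gt0 : 0 < h.
Implicit Types u v : R.

Let multiples u v := [set z : int | u <= h * z%:~R < v].

Let multiplesE u v : multiples u v =
  [set z | Num.ceil (u / h) <= z <
    Num.ceil (u / h) + (absz (Num.max 0 (Num.ceil (v / h) - Num.ceil (u / h))))%:Z].
Proof.
apply/seteqP; split=> z; rewrite /multiples /= [h * _]mulrC -ler_pdivrMr // -ltr_pdivlMr //;
  rewrite -ceil_le_int -ceil_gt_int gez0_abs ?le_max ?lexx // addr_maxr addr0 subrKC lt_max.
  by move=> /andP[-> ->]; rewrite orbT.
by move=> /andP[uz]; rewrite uz /= => /orP[|//]; rewrite ltNge uz.
Qed.

Lemma finite_multiples u v : finite_set (multiples u v).
Proof. by rewrite multiplesE; exact: finite_int_itv. Qed.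

Lemma multiples_card u v :
  `|h * (set_card (multiples u v))%:R - Num.max 0 (v - u)| <= h.
Proof.
rewrite multiplesE set_card_int_itv natr_absz [X in h * X%:~R]ger0_norm ?le_max ?lexx //.
have /andP[u1 u2] := ceil_itv (u / h); have /andP[v1 v2] := ceil_itv (v / h).
have max_scaled (c d : int) :
    h * (Num.max 0 (d - c))%:~R = Num.max 0 (d%:~R * h - c%:~R * h).
  have -> : (Num.max 0 (d - c))%:~R = Num.max 0 (d%:~R - c%:~R) :> R.
    by rewrite -rmorphB !maxEle ler0z; case: ifP.
  by rewrite mulrC maxr_pMl ?(ltW h_gt0) // mul0r mulrBl.
rewrite max_scaled; move: u1 u2 v1 v2; rewrite !rmorphB /=.
rewrite !(ler_pdivrMr, ltr_pdivlMr) // !mulrBl mul1r.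
move: (_ * h) (_ * h) => cv cu u1 u2 v1 v2.
by rewrite ler_norml; case: (leP 0 (v - u)); case: (leP 0 (cv - cu)) => *; apply/andP; split; lra.
Qed.

End IntegerPoints.

Section GridCount.
Variables (R : realType) (k : nat).
Implicit Types a b : 'rV[R]_k.

Definition grid_points (h : R) a b : set 'rV[int]_k :=
  [set z | box a b (h *: map_mx intr z)].

Let coord_multiples (h : R) a b i := [set z : int | a ord0 i <= h * z%:~R < b ord0 i].

Let grid_pointsE h a b :
  grid_points h a b = [set z | forall i, coord_multiples h a b i (z ord0 i)].
Proof.
apply/seteqP; split=> z zab i; have := zab i; rewrite /coord_multiples /= !mxE => zi;
  exact/andP.
Qed.

Let finite_coord_multiples h a b i : 0 < h -> finite_set (coord_multiples h a b i).
Proof. by move=> h0; exact: finite_multiples. Qed.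

Lemma finite_grid_points h a b : 0 < h -> finite_set (grid_points h a b).
Proof.
move=> h0; rewrite grid_pointsE.
by apply: (@finite_set_rV _ _ (coord_multiples h a b)) => i; exact: finite_coord_multiples.
Qed.

Lemma grid_points_cvg a b :
  h ^+ k * (set_card (grid_points h a b))%:R @[h --> 0^'+] --> box_vol a b.
Proof.
have prodE : \forall h \near 0^'+,
    \prod_i (h * (set_card (coord_multiples h a b i))%:R) =
    h ^+ k * (set_card (grid_points h a b))%:R.
  near=> h; rewrite grid_pointsE set_card_rV => [|i]; last exact: finite_coord_multiples.
  by rewrite big_split /= prodr_const card_ord natr_prod.
apply: cvg_trans (near_eq_cvg prodE) _; apply: cvg_big => [|i _].
  exact: mul_continuous.
pose l := Num.max 0 (b ord0 i - a ord0 i).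
apply: (@squeeze_cvgr _ _ _ _ (fun h => l - h) (fun h => l + h)).
- near=> h; have := @multiples_card R h _ (a ord0 i) (b ord0 i).
  by rewrite ler_norml => /(_ _)/andP[//|? ?]; apply/andP; split; rewrite /l; lra.
- by rewrite -[X in _ --> X]subr0; apply: cvgB; [exact: cvg_cst|exact: cvg_within].
- by rewrite -[X in _ --> X]addr0; apply: cvgD; [exact: cvg_cst|exact: cvg_within].
Unshelve. all: by end_near. Qed.

(* Both sides are limits of the numbers of grid points, normalised by the mesh. *)
Lemma box_vol_sum_le (U V : choiceType) (s : seq U) (t : seq V)
    (a b : U -> 'rV[R]_k) (c d : V -> 'rV[R]_k) :
  uniq s -> trivIset [set` s] (fun i => box (a i) (b i)) ->
  \bigcup_(i in [set` s]) box (a i) (b i) `<=` \bigcup_(j in [set` t]) box (c j) (d j) ->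
  \sum_(i <- s) box_vol (a i) (b i) <= \sum_(j <- t) box_vol (c j) (d j).
Proof.
move=> s_uniq disj sub.
have sum_cvg (W : choiceType) (r : seq W) (u v : W -> 'rV[R]_k) :
    \sum_(i <- r) h ^+ k * (set_card (grid_points h (u i) (v i)))%:R @[h --> 0^'+] -->
    \sum_(i <- r) box_vol (u i) (v i).
  by apply: cvg_big => [|i _]; [exact: add_continuous|exact: grid_points_cvg].
apply: (ler_cvg_to (sum_cvg _ s a b) (sum_cvg _ t c d)); near=> h.
have h0 : 0 < h by [].
rewrite -!mulr_sumr ler_wpM2l ?exprn_ge0 ?(ltW h0) // -!natr_sum ler_nat.
have fin : finite_set (\bigcup_(i in [set` s]) grid_points h (a i) (b i)).
  by apply: bigcup_finite => // i _; exact: finite_grid_points.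
apply: leq_trans (set_card_ge_packing s_uniq fin _ (@subset_refl _ _)) _.
  by move=> i j si sj [z [zi zj]]; apply: disj => //; exists (h *: map_mx intr z).
apply: set_card_le_cover => [j _|z [i si zi]]; first exact: finite_grid_points.
by have [|j tj zj] := sub (h *: map_mx intr z); [exists i|exists j].
Unshelve. all: by end_near. Qed.

End GridCount.

(** * Lebesgue outer measure *)

Section LebesgueVolume.
Variables (R : realType) (k : nat).
Implicit Types (a b u : 'rV[R]_k) (A K : set 'rV[R]_k).

Lemma leb_vol_ge0 A : (0 <= leb_vol A)%E.
Proof.
apply: le_ereal_inf_tmp => _ [ab _ <-].
by apply: nneseries_ge0 => i _ _; rewrite lee_fin box_vol_ge0.
Qed.

Lemma le_leb_vol A K : A `<=` K -> (leb_vol A <= leb_vol K)%E.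
Proof.
move=> AK; apply: le_ereal_inf_tmp => _ [ab /= Kab <-].
by apply: ereal_inf_lbound; exists ab => //=; exact: subset_trans Kab.
Qed.

Lemma box_vol_homothety (l : R) u a b : 0 <= l ->
  box_vol (u + l *: a) (u + l *: b) = l ^+ k * box_vol a b.
Proof.
move=> l0; rewrite /box_vol -[X in l ^+ X]card_ord -prodr_const -big_split /=.
apply: eq_bigr => i _; rewrite !mxE maxr_pMr // mulr0.
by congr Num.max; ring.
Qed.

Lemma leb_vol_homothety (l : R) u A : 0 < l ->
  leb_vol [set u + l *: x | x in A] = ((l ^+ k)%:E * leb_vol A)%E.
Proof.
have le_homothety (r : R) (v : 'rV[R]_k) (C : set 'rV[R]_k) : 0 < r ->
    (leb_vol [set (v + r *: x)%R | x in C] <= (r ^+ k)%:E * leb_vol C)%E.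
  move=> r0; rewrite -lee_pdivrMl ?exprn_gt0 //.
  apply: le_ereal_inf_tmp => _ [ab /= Cab <-].
  rewrite lee_pdivrMl ?exprn_gt0 // -nneseriesZl; last first.
    by move=> i _; rewrite lee_fin box_vol_ge0.
  apply: ereal_inf_lbound.
  exists (fun j => v + r *: ab.1 j, fun j => v + r *: ab.2 j) => /=.
    move=> _ [x Cx <-]; have [j _ xab] := Cab x Cx; exists j => // i.
    by have [] := xab i; rewrite !mxE lerD2l ltrD2l ler_pM2l // ltr_pM2l.
  by apply: eq_eseriesr => j _ /=; rewrite -EFinM box_vol_homothety // ltW.
move=> l0; apply/eqP; rewrite eq_le le_homothety //=.
have := @le_homothety l^-1 (- (l^-1 *: u)) [set u + l *: x | x in A].
rewrite invr_gt0 image_comp exprVn => /(_ l0).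
rewrite [X in leb_vol X](_ : _ = A); last first.
  rewrite -[RHS]image_id; apply: eq_imagel => x _ /=.
  by rewrite scalerDr scalerA mulVf ?gt_eqF // scale1r addKr.
by rewrite lee_pdivlMl // exprn_gt0.
Qed.

Lemma leb_vol_translate u A : leb_vol [set u + x | x in A] = leb_vol A.
Proof.
rewrite -[RHS]mul1e -[X in (X%:E * _)%E](expr1n R k) -(leb_vol_homothety u A ltr01).
by congr leb_vol; apply: eq_imagel => x _; rewrite scale1r.
Qed.

Lemma box_vol_enlarge a b (e : R) : 0 < e ->
  exists d, 0 < d /\ box_vol (a - const_mx d) (b + const_mx d) <= box_vol a b + e.
Proof.
move=> e0.
have vol_cvg : box_vol (a - const_mx d) (b + const_mx d) @[d --> 0^'+] --> box_vol a b.
  by apply: cvg_box_vol; [exact: cvgB_const_mx0|exact: cvgD_const_mx0].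
have vol_lt : \forall d \near 0^'+, box_vol (a - const_mx d) (b + const_mx d) < box_vol a b + e.
  by apply: (cvgr_lt _ vol_cvg); rewrite ltrDl.
by near (0:R)^'+ => d; exists d; split; [|apply/ltW; near: d].
Unshelve. all: by end_near. Qed.

Lemma subset_interior_box a b (d : R) : 0 < d ->
  box a b `<=` (box (a - const_mx d) (b + const_mx d))°.
Proof.
move=> d0 x xab; apply/nbhs_ballP; exists d => // y.
rewrite -ball_normE => /= /(rV_norm_ltP _ d0) xy i.
have := xy i; have := xab i; rewrite !mxE ltr_norml => -[? ?] /andP[? ?]; split; lra.
Qed.

Lemma open_box_cover A (v : R) : (leb_vol A < v%:E)%E ->
  exists2 ab : nat -> 'rV[R]_k * 'rV[R]_k,
    A `<=` \bigcup_j (box (ab j).1 (ab j).2)° &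
    (\sum_(0 <= j <oo) (box_vol (ab j).1 (ab j).2)%:E < v%:E)%E.
Proof.
move=> /ereal_inf_lt[_ [[a b] /= Aab <-]]; set S := (X in (X < _)%E) => Sv.
have S_fin : S \is a fin_num.
  rewrite ge0_fin_numE ?(lt_trans Sv) ?ltry //.
  by apply: nneseries_ge0 => i _ _; rewrite lee_fin box_vol_ge0.
rewrite -(fineK S_fin) lte_fin -subr_gt0 in Sv; set e := v - _ in Sv.
have e_gt0 j : 0 < e / 2 / (2 ^ j.+1)%:R by rewrite !divr_gt0 // ltr0n expn_gt0.
have [d d_spec] := choice (fun j => box_vol_enlarge (a j) (b j) (e_gt0 j)).
exists (fun j => (a j - const_mx (d j), b j + const_mx (d j))) => /=.
  move=> x /Aab[j _ xab]; exists j => //=.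
  by have [d_gt0 _] := d_spec j; exact: subset_interior_box.
apply: (@le_lt_trans _ _ (S + (e / 2)%:E)%E); last first.
  by rewrite -(fineK S_fin) -EFinD lte_fin; move: Sv; rewrite /e; lra.
have e2_ge0 : 0 <= e / 2 by rewrite divr_ge0 // ltW.
have vol_ge0 j : (0 <= (box_vol (a j) (b j))%:E)%E by rewrite lee_fin box_vol_ge0.
apply: le_trans (epsilon_trick xpredT vol_ge0 e2_ge0).
apply: lee_nneseries => j _ *; first by rewrite lee_fin box_vol_ge0.
by rewrite -EFinD lee_fin; have [] := d_spec j.
Qed.

Lemma compact_box_cover K (v : R) : compact K -> (leb_vol K < v%:E)%E ->
  exists2 bs : seq ('rV[R]_k * 'rV[R]_k),
    K `<=` \bigcup_(ab in [set` bs]) (box ab.1 ab.2)° &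
    \sum_(ab <- bs) box_vol ab.1 ab.2 < v.
Proof.
move=> K_compact /open_box_cover[ab Kab ab_v].
have [N _ KN] : \forall N \near \oo, K `<=` \bigcup_(j < N) (box (ab j).1 (ab j).2)°.
  apply: (compact_near_coveringP K).1 => // x /Kab[j _ xab].
  exists ((box (ab j).1 (ab j).2)°, [set N | (j < N)%N]) => /=.
    split; last by exists j.+1.
    by apply: open_nbhs_nbhs; split => //; exact: open_interior.
  by move=> [y N] /= [yj jN]; exists j.
exists [seq ab j | j <- iota 0 N].
  move=> x /(KN N (leqnn N))[j /= jN xj]; exists (ab j) => //=.
  by apply: map_f; rewrite mem_iota.
rewrite big_map -lte_fin -sumEFin; apply: le_lt_trans ab_v.
have := @nneseries_lim_ge R (fun j => (box_vol (ab j).1 (ab j).2)%:E) xpredT 0 N.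
by rewrite /index_iota subn0; apply => j _ _; rewrite lee_fin box_vol_ge0.
Qed.

Lemma leb_vol_ge_boxes (U : choiceType) (s : seq U) (a b : U -> 'rV[R]_k) A :
  uniq s -> trivIset [set` s] (fun i => box (a i) (b i)) ->
  \bigcup_(i in [set` s]) box (a i) (b i) `<=` A ->
  ((\sum_(i <- s) box_vol (a i) (b i))%:E <= leb_vol A)%E.
Proof.
move=> s_uniq disj sub.
pose shrunk d i := [set x : 'rV[R]_k | forall j,
  `[a i ord0 j, (b i - const_mx d) ord0 j]%classic (x ord0 j)].
have box_shrunk d i : box (a i) (b i - const_mx d) `<=` shrunk d i.
  by move=> x xab j; have [? /ltW ?] := xab j; rewrite /= in_itv /=; exact/andP.
have shrunk_box d i : 0 < d -> shrunk d i `<=` box (a i) (b i).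
  move=> d0 x xab j; have := xab j; rewrite /= in_itv /= !mxE => /andP[? ?]; split; lra.
have sum_le d : 0 < d -> ((\sum_(i <- s) box_vol (a i) (b i - const_mx d))%:E <= leb_vol A)%E.
  move=> d0; pose K := \bigcup_(i in [set` s]) shrunk d i.
  have K_compact : compact K.
    rewrite /K bigcup_seq; apply: bigsetU_compact => i _.
    apply: (@rV_compact R k (fun j => `[a i ord0 j, (b i - const_mx d) ord0 j]%classic)).
    by move=> j; exact: segment_compact.
  have KA : K `<=` A by apply: subset_trans sub; apply: subset_bigcup => i _; exact: shrunk_box.
  apply: le_trans (le_leb_vol KA); rewrite leNgt; apply/negP.
  move=> /(compact_box_cover K_compact)[bs Kbs]; apply/negP; rewrite -leNgt.
  apply: box_vol_sum_le => //.
    move=> i j si sj [x [xi xj]]; apply: disj => //.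
    by exists x; split; apply: (shrunk_box d); rewrite ?d0 //; exact: box_shrunk.
  apply: (@subset_trans _ K).
    by apply: subset_bigcup => i _; exact: box_shrunk.
  by apply: subset_trans Kbs _; apply: subset_bigcup => ab _; exact: interior_subset.
have sum_cvg : \sum_(i <- s) box_vol (a i) (b i - const_mx d) @[d --> 0^'+] -->
    \sum_(i <- s) box_vol (a i) (b i).
  apply: cvg_big => [|i _]; first exact: add_continuous.
  by apply: cvg_box_vol; [exact: cvg_cst|exact: cvgB_const_mx0].
case: (leb_vol A) (leb_vol_ge0 A) sum_le => [v||] // _ sum_le; last by rewrite leey.
rewrite lee_fin; apply: (cvgr_to_le sum_cvg); near=> d.
by rewrite -lee_fin; exact: sum_le.
Unshelve. all: by end_near. Qed.

Definition dilation (d : R) A : set 'rV[R]_k := [set x | exists2 y, A y & `|x - y| < d].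
Definition erosion (d : R) A : set 'rV[R]_k := [set x | forall y, `|x - y| < d -> A y].
Definition vol A : R := fine (leb_vol A).

Hypothesis k_gt0 : (0 < k)%N.

(* The cover is padded by empty boxes, which have volume 0 only in positive dimension. *)
Lemma leb_vol_le_boxes (V : choiceType) (t : seq V) (a b : V -> 'rV[R]_k) A :
  A `<=` \bigcup_(j in [set` t]) box (a j) (b j) ->
  (leb_vol A <= (\sum_(j <- t) box_vol (a j) (b j))%:E)%E.
Proof.
move=> cov; pose bs := [seq (a j, b j) | j <- t]; pose f j := nth (0, 0) bs j.
apply: (@le_trans _ _ (\sum_(0 <= j <oo) (box_vol (f j).1 (f j).2)%:E)%E).
  apply: ereal_inf_lbound; exists (fun j => (f j).1, fun j => (f j).2) => //= x /cov[j tj xab].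
  exists (index (a j, b j) bs) => //=; rewrite /f nth_index //.
  exact: (map_f (fun j => (a j, b j))).
rewrite (nneseries_split 0 (size bs)); last by move=> *; rewrite lee_fin box_vol_ge0.
rewrite add0n eseries0 ?adde0; last first.
  move=> i bi _; rewrite /f nth_default //; congr EFin.
  by rewrite /box_vol (bigD1 (Ordinal k_gt0)) //= subrr maxxx mul0r.
by rewrite sumEFin lee_fin -[X in _ <= X](big_map (fun j => (a j, b j)) xpredT
  (fun ab => box_vol ab.1 ab.2)) -/bs (big_nth (0, 0)).
Qed.

Lemma leb_vol0 : leb_vol (set0 : set 'rV[R]_k) = 0%E.
Proof.
apply/eqP; rewrite eq_le leb_vol_ge0 andbT.
have := @leb_vol_le_boxes nat [::] (fun=> 0) (fun=> 0) set0.
by rewrite big_nil; apply; exact: sub0set.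
Qed.

Lemma volE A : bounded_set A -> leb_vol A = (vol A)%:E.
Proof.
move=> /bounded_setP[M M0 AM]; rewrite /vol fineK // ge0_fin_numE ?leb_vol_ge0 //.
pose a : 'rV[R]_k := const_mx (- M); pose b : 'rV[R]_k := const_mx (M + 1).
have Aab : A `<=` \bigcup_(j in [set` [:: tt]]) box a b.
  move=> x /AM xM; exists tt => // i; have := le_trans (coord_norm_le x i) xM.
  rewrite !mxE ler_norml => /andP[? ?]; split; lra.
by apply: le_lt_trans (leb_vol_le_boxes Aab) _; rewrite ltry.
Qed.

Lemma compact_leb_vol_dilation K (v : R) : compact K -> (leb_vol K < v%:E)%E ->
  \forall d \near 0^'+, (leb_vol (dilation d K) < v%:E)%E.
Proof.
move=> K_compact /(compact_box_cover K_compact)[bs Kbs bs_v].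
pose U := \bigcup_(ab in [set` bs]) box ab.1 ab.2.
have : \forall d \near 0^'+, K `<=` [set x | ball x d `<=` U].
  apply: (compact_near_coveringP K).1 => // x /Kbs[ab bs_ab /nbhs_ballP[e /= e0 xe]].
  exists (ball x (e / 2), [set d | d < e / 2]) => /=.
    split; first by apply: nbhsx_ballx; rewrite divr_gt0.
    by apply: nbhs_right_lt; rewrite divr_gt0.
  move=> [x' d] /= [xx' de] y x'y; exists ab => //; apply: xe.
  by rewrite (splitr e); apply: ball_triangle xx' _; apply: le_ball x'y; exact: ltW.
apply: filterS => d KU; apply: (@le_lt_trans _ _ (\sum_(ab <- bs) box_vol ab.1 ab.2)%:E).
  apply: leb_vol_le_boxes => x [y Ky xy]; apply: (KU y Ky).
  by rewrite -ball_normE /= distrC.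
by rewrite lte_fin.
Qed.

Lemma compact_leb_volU A K : compact A -> compact K ->
  (leb_vol (A `|` K) <= leb_vol A + leb_vol K)%E.
Proof.
move=> A_compact K_compact; have AK_compact := compactU A_compact K_compact.
have volC C : compact C -> leb_vol C = (vol C)%:E by move=> /compact_bounded/volE.
have cover C : compact C -> forall e, 0 < e -> exists2 bs : seq ('rV[R]_k * 'rV[R]_k),
    C `<=` \bigcup_(ab in [set` bs]) (box ab.1 ab.2)° &
    \sum_(ab <- bs) box_vol ab.1 ab.2 < vol C + e.
  by move=> cC e e0; apply: compact_box_cover => //; rewrite volC // lte_fin ltrDl.
rewrite !volC // -EFinD lee_fin; apply/ler_addgt0Pr => e e0.
have e20 : 0 < e / 2 by rewrite divr_gt0.
have [bs Abs bs_vol] := cover A A_compact _ e20.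
have [cs Kcs cs_vol] := cover K K_compact _ e20.
have : A `|` K `<=` \bigcup_(ab in [set` bs ++ cs]) box ab.1 ab.2.
  by move=> x [/Abs|/Kcs] [ab ab_in /interior_subset xab]; exists ab => //=;
    rewrite mem_cat ab_in ?orbT.
move=> /leb_vol_le_boxes; rewrite volC // lee_fin big_cat /= => /le_trans; apply; lra.
Qed.

End LebesgueVolume.

(** * Grid cubes and Jordan measurability *)

Section Boundary.
Variable T : topologicalType.
Implicit Types A C K : set T.

Definition boundary K := closure K `\` K°.

Lemma boundaryI A K : boundary (A `&` K) `<=` boundary A `|` boundary K.
Proof.
rewrite /boundary interiorI => x [/closureI[Ax Kx] nAK].
by have [Aox|] := pselect (A° x); [right; split=> // Kox; apply: nAK|left].
Qed.

Lemma connected_meets_boundary C K : connected C -> C `&` K !=set0 -> ~ C `<=` K ->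
  C `&` boundary K !=set0.
Proof.
move=> C_conn [x [Cx Kx]] nCK; apply: contrapT => no_boundary; apply: nCK.
have CKE : C `&` closure K = C `&` K°.
  apply/seteqP; split=> y [Cy Ky]; split=> //; last first.
    by apply: subset_closure; exact: interior_subset Ky.
  by apply: contrapT => nKy; apply: no_boundary; exists y.
suff <- : C `&` K° = C by move=> y [_ /interior_subset].
apply: C_conn; first by exists x; rewrite -CKE; split=> //; exact: subset_closure.
  by exists K° => //; exact: open_interior.
by exists (closure K); [exact: closed_closure|rewrite CKE].
Qed.

End Boundary.

Lemma line_segment_connected (R : realType) (V : normedModType R) (x y : V) :
  connected [set x + s *: (y - x) | s in `[0, 1]%classic].
Proof.
apply: connected_continuous_connected; first exact: segment_connected.
apply: continuous_subspaceT => s; apply: cvgD; first exact: cvg_cst.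
by apply: cvgZr_tmp; exact: cvg_id.
Qed.

Section Cubes.
Variables (R : realType) (k : nat).
Implicit Types (x y u : 'rV[R]_k) (h : R) (a : 'rV[int]_k) (A K : set 'rV[R]_k).

Definition cube x h : set 'rV[R]_k := box x (x + const_mx h).
Definition corner h a : 'rV[R]_k := h *: map_mx intr a.
Definition outer h A : set 'rV[int]_k := [set a | cube (corner h a) h `&` A !=set0].
Definition inner h A : set 'rV[int]_k := [set a | cube (corner h a) h `<=` A].

Lemma cube_corner h a : 0 < h -> cube (corner h a) h (corner h a).
Proof. by move=> h0 i; rewrite !mxE lexx ltrDl. Qed.

Lemma cube_dist h x y z : 0 < h -> cube z h x -> cube z h y -> `|x - y| < h.
Proof.
move=> h0 zx zy; apply/rV_norm_ltP => // i; have := zx i; have := zy i; rewrite !mxE.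
by move=> [? ?] [? ?]; rewrite ltr_norml; apply/andP; split; lra.
Qed.

Lemma cube_segment h x y z (s : R) : 0 <= s <= 1 -> cube z h x -> cube z h y ->
  cube z h (x + s *: (y - x)).
Proof.
move=> /andP[s0 s1] zx zy i; have := zx i; have := zy i; rewrite !mxE.
move: (z ord0 i) (x ord0 i) (y ord0 i) => u v w [uw wu] [uv vu]; split; first by nra.
have [->|s_neq0] := eqVneq s 0; first by rewrite mul0r addr0.
have sw : 0 < s * (u + h - w) by rewrite mulr_gt0 ?subr_gt0 // lt_def s_neq0.
have sv : 0 <= (1 - s) * (u + h - v) by rewrite mulr_ge0 ?subr_ge0 // ltW.
nra.
Qed.

Lemma cube_cornerP h a x : 0 < h ->
  cube (corner h a) h x <-> a = \row_i Num.floor (x ord0 i / h).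
Proof.
move=> h0; split=> [xa|-> i].
  apply/rowP => i; rewrite mxE; apply/esym/floor_def; have := xa i; rewrite !mxE.
  by rewrite ler_pdivlMr // ltr_pdivrMr // intrD => -[? ?]; apply/andP; split; lra.
have /andP[] := floor_itv (x ord0 i / h); rewrite !mxE.
by rewrite ler_pdivlMr // ltr_pdivrMr // intrD => ? ?; split; lra.
Qed.

Lemma trivIset_cube h (D : set 'rV[int]_k) : 0 < h ->
  trivIset D (fun a => cube (corner h a) h).
Proof. by move=> h0 a b _ _ [x [/cube_cornerP-> // /cube_cornerP->]]. Qed.

Lemma outer_cover h A : 0 < h -> A `<=` \bigcup_(a in outer h A) cube (corner h a) h.
Proof.
move=> h0 x Ax; pose a : 'rV[int]_k := \row_i Num.floor (x ord0 i / h).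
have xa : cube (corner h a) h x by exact/cube_cornerP.
by exists a => //; exists x.
Qed.

Lemma inner_outer h A : 0 < h -> inner h A `<=` outer h A.
Proof.
by move=> h0 a aA; exists (corner h a); split; [|apply: aA]; exact: cube_corner.
Qed.

Lemma finite_outer h A : 0 < h -> bounded_set A -> finite_set (outer h A).
Proof.
move=> h0 /bounded_setP[M M0 AM].
apply: sub_finite_set (finite_grid_points (const_mx (- (M + h))) (const_mx (M + h)) h0).
move=> a [x [ax /AM xM]] i.
have := coord_norm_le x i; have := ax i; rewrite !mxE => -[? ?] /le_trans/(_ xM).
by rewrite ler_norml => /andP[? ?]; split; lra.
Qed.

Lemma finite_inner h A : 0 < h -> bounded_set A -> finite_set (inner h A).
Proof. by move=> h0 /(finite_outer h0); apply: sub_finite_set; exact: inner_outer. Qed.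

Lemma inner_card_le_outer h A : 0 < h -> bounded_set A ->
  (set_card (inner h A) <= set_card (outer h A))%N.
Proof. by move=> h0 bA; apply: subset_set_card (inner_outer h0); exact: finite_outer. Qed.

Lemma outer_sub_inner_dilation h A : 0 < h -> outer h A `<=` inner h (dilation h A).
Proof. by move=> h0 a [x [ax Ax]] y ay; exists x => //; exact: cube_dist ay ax. Qed.

Lemma outer_split h K : 0 < h -> outer h K `<=` inner h K `|` outer h (boundary K).
Proof.
move=> h0 a [x [ax Kx]]; have [|n_inner] := pselect (inner h K a); [by left|right].
have [y ay nKy] : exists2 y, cube (corner h a) h y & ~ K y.
  by apply: contrapT => no_point; apply: n_inner => y ay; apply: contrapT => nKy;
    apply: no_point; exists y.
have [|Kseg|z [[s s01 <-] bz]] :=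
  @connected_meets_boundary _ _ K (@line_segment_connected R _ x y).
- by exists x; split=> //; exists 0; rewrite /= ?in_itv /= ?lexx ?ler01 ?scale0r ?addr0.
- apply: nKy; apply: Kseg; exists 1; first by rewrite /= in_itv /= ler01 lexx.
  by rewrite scale1r addrC subrK.
- exists (x + s *: (y - x)); split=> //; apply: cube_segment ax ay.
  by move: s01; rewrite /= in_itv.
Qed.

Lemma bounded_dilation (d : R) A : bounded_set A -> bounded_set (dilation d A).
Proof.
move=> /bounded_setP[M M0 AM]; apply/bounded_setP; exists (M + `|d|).
  by rewrite ltr_pwDl.
move=> x [y /AM yM xy]; rewrite -(subrK y x) addrC (le_trans (ler_normD _ _)) // lerD //.
by rewrite (le_trans (ltW xy)) // ler_norm.
Qed.

Lemma erosion_sub (d : R) A : 0 < d -> erosion d A `<=` A.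
Proof. by move=> d0 x; apply; rewrite subrr normr0. Qed.

Lemma sum_box_vol_cubes h (D : set 'rV[int]_k) : 0 <= h ->
  \sum_(a <- fset_set D) box_vol (corner h a) (corner h a + const_mx h) =
  (set_card D)%:R * h ^+ k.
Proof.
move=> h0; rewrite (eq_bigr (fun=> h ^+ k)) => [|a _]; last exact: box_vol_cube.
by rewrite sumr_const_set_card mulr_natl.
Qed.

Hypothesis k_gt0 : (0 < k)%N.

Lemma vol_le_outer h A : 0 < h -> bounded_set A ->
  vol A <= (set_card (outer h A))%:R * h ^+ k.
Proof.
move=> h0 bA; rewrite -lee_fin -volE // -sum_box_vol_cubes ?(ltW h0) //.
by apply: leb_vol_le_boxes => //; rewrite fset_setK; [exact: outer_cover|exact: finite_outer].
Qed.

Lemma inner_le_vol h A : 0 < h -> bounded_set A ->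
  (set_card (inner h A))%:R * h ^+ k <= vol A.
Proof.
move=> h0 bA; rewrite -lee_fin -volE // -sum_box_vol_cubes ?(ltW h0) //.
apply: leb_vol_ge_boxes; rewrite ?fset_uniq // fset_setK; try exact: finite_inner.
- exact: trivIset_cube.
- by move=> x [a aA /aA].
Qed.

Lemma outer_le_vol_dilation h A : 0 < h -> bounded_set A ->
  (set_card (outer h A))%:R * h ^+ k <= vol (dilation h A).
Proof.
move=> h0 bA; have bdA := bounded_dilation h bA.
apply: le_trans (inner_le_vol h0 bdA); rewrite ler_wpM2r ?exprn_ge0 ?(ltW h0) // ler_nat.
by apply: subset_set_card (outer_sub_inner_dilation h0); exact: finite_inner.
Qed.

Lemma compact_outer_cvg K : compact K ->
  (set_card (outer h K))%:R * h ^+ k @[h --> 0^'+] --> vol K.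
Proof.
move=> K_compact; have K_bounded := compact_bounded K_compact.
apply/cvgrPdist_lt => e e0; near=> h; have h0 : 0 < h by [].
have KdK : (set_card (outer h K))%:R * h ^+ k < vol K + e.
  apply: le_lt_trans (outer_le_vol_dilation h0 K_bounded) _.
  rewrite -lte_fin -volE //; last exact: bounded_dilation.
  near: h; apply: compact_leb_vol_dilation => //.
  by rewrite volE // lte_fin ltrDl.
have := vol_le_outer h0 K_bounded; rewrite ltr_norml => ?; apply/andP; split; lra.
Unshelve. all: by end_near. Qed.

Definition jordan_measurable A :=
  [/\ bounded_set A,
      (set_card (outer h A))%:R * h ^+ k @[h --> 0^'+] --> vol A &
      (set_card (inner h A))%:R * h ^+ k @[h --> 0^'+] --> vol A].

Definition null_boundary K := leb_vol (boundary K) = 0%E.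

Lemma compact_set_closed K : compact K -> closed K.
Proof. by apply: compact_closed; exact: norm_hausdorff. Qed.

Lemma compact_boundary K : compact K -> compact (boundary K).
Proof.
move=> K_compact; rewrite /boundary -(closure_id K).1; last exact: compact_set_closed.
rewrite setDE; apply: (compact_closedI K_compact).
by apply: open_closedC; exact: open_interior.
Qed.

Lemma compact_jordan_measurable K : compact K -> null_boundary K -> jordan_measurable K.
Proof.
move=> K_compact K_null; have K_bounded := compact_bounded K_compact.
have outer_cvg := compact_outer_cvg K_compact.
have boundary_cvg := compact_outer_cvg (compact_boundary K_compact).
rewrite /vol K_null /= in boundary_cvg.
split=> //; apply: (@squeeze_cvgr _ _ _ _ (fun h => (set_card (outer h K))%:R * h ^+ k -
    (set_card (outer h (boundary K)))%:R * h ^+ k) (fun=> vol K)); last exact: cvg_cst.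
- near=> h; have h0 : 0 < h by [].
  apply/andP; split; last exact: inner_le_vol.
  rewrite lerBlDr -mulrDl ler_wpM2r ?exprn_ge0 ?(ltW h0) // -natrD ler_nat.
  have fin_inner := finite_inner h0 K_bounded.
  have fin_bd := finite_outer h0 (compact_bounded (compact_boundary K_compact)).
  apply: leq_trans (set_cardU_le fin_inner fin_bd).
  by apply: subset_set_card (@outer_split _ _ h0); rewrite finite_setU.
- by rewrite -[X in _ --> X]subr0; exact: cvgB.
Unshelve. all: by end_near. Qed.

Lemma jordan_erosion A (v : R) : jordan_measurable A -> v < vol A ->
  \forall d \near 0^'+, (v%:E < leb_vol (erosion d A))%E.
Proof.
move=> [bA _ inner_cvg] vA.
have [h [h0 v_inner]] : exists h, 0 < h /\ v < (set_card (inner h A))%:R * h ^+ k.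
  exact: filter_ex (filterI (nbhs_right_gt 0) (cvgr_gt _ inner_cvg _ vA)).
pose I := fset_set (inner h A).
have shrink_cvg : \sum_(a <- I) box_vol (corner h a + const_mx d)
    (corner h a + const_mx h - const_mx d) @[d --> 0^'+] -->
    (set_card (inner h A))%:R * h ^+ k.
  rewrite -sum_box_vol_cubes ?(ltW h0) //.
  apply: cvg_big => [|a _]; first exact: add_continuous.
  by apply: cvg_box_vol; [exact: cvgD_const_mx0|exact: cvgB_const_mx0].
near=> d; have d0 : 0 < d by [].
apply: (@lt_le_trans _ _ (\sum_(a <- I) box_vol (corner h a + const_mx d)
    (corner h a + const_mx h - const_mx d))%:E).
  by rewrite lte_fin; near: d; apply: cvgr_gt shrink_cvg _ v_inner.
have box_dist a x y : box (corner h a + const_mx d) (corner h a + const_mx h - const_mx d) x ->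
    `|x - y| < d -> cube (corner h a) h y.
  move=> xa /(rV_norm_ltP _ d0) xy i; have := xy i; have := xa i; rewrite !mxE ltr_norml.
  by move=> [? ?] /andP[? ?]; split; lra.
apply: leb_vol_ge_boxes; rewrite ?fset_uniq // fset_setK; try exact: finite_inner.
- move=> a b _ _ [x [xa xb]]; apply: (trivIset_cube h0 (D := setT)) => //.
  by exists x; split; [move: xa|move: xb] => /box_dist; apply; rewrite subrr normr0.
- by move=> x [a aA xa] y xy; apply: aA; exact: box_dist xa xy.
Unshelve. all: by end_near. Qed.

Lemma null_boundaryI A K : compact A -> compact K ->
  null_boundary A -> null_boundary K -> null_boundary (A `&` K).
Proof.
move=> A_compact K_compact A_null K_null; apply/eqP; rewrite eq_le leb_vol_ge0 andbT.
apply: le_trans (le_leb_vol (@boundaryI _ A K)) _.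
by apply: le_trans (compact_leb_volU _ _ _) _; rewrite ?A_null ?K_null ?adde0 //;
  exact: compact_boundary.
Qed.

Lemma compact_translate u K : compact K -> compact [set u + x | x in K].
Proof.
apply: continuous_compact; apply: continuous_subspaceT => x.
by apply: (@continuousD _ _ _ (fun=> u) id); [exact: cst_continuous|exact: cvg_id].
Qed.

Lemma null_boundary_translate u K : compact K ->
  null_boundary K -> null_boundary [set u + x | x in K].
Proof.
move=> K_compact K_null; apply/eqP; rewrite eq_le leb_vol_ge0 andbT -K_null.
rewrite -(leb_vol_translate u (boundary K)); apply: le_leb_vol.
rewrite /boundary -(closure_id [set u + x | x in K]).1; last first.
  by apply: compact_set_closed; exact: compact_translate.
move=> _ [[x Kx <-] nKux]; exists x => //; split=> [|Kox]; first exact: subset_closure.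
apply: nKux.
have uKo_open : open ((fun y => y - u) @^-1` K°).
  apply: open_comp; last exact: open_interior.
  by move=> y _; apply: (@continuousB _ _ _ id (fun=> u)); [exact: cvg_id|exact: cst_continuous].
have : (fun y => y - u) @^-1` K° `<=` [set u + x | x in K].
  by move=> y /interior_subset Kyu; exists (y - u); rewrite // subrKC.
by rewrite open_subsetE //; apply; rewrite /= addrC addKr.
Qed.

End Cubes.

(** * Euclidean balls and van Hove families *)

Lemma cvg_exprn (R : realType) (T : Type) (F : set_system T) {FF : Filter F}
    (f : T -> R) (l : R) (n : nat) : f @ F --> l -> f t ^+ n @[t --> F] --> l ^+ n.
Proof.
move=> fl; apply: (@continuous_cvg _ _ _ _ _ f (fun x : R => x ^+ n)) fl.
exact: exprn_continuous.
Qed.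

Lemma cvgy_shift_ratio (R : realType) (c : R) (n : nat) :
  ((r + c) / r) ^+ n @[r --> +oo] --> (1 : R).
Proof.
rewrite -[X in _ --> X](expr1n R n); apply: cvg_exprn.
have ratioE : \forall r \near +oo, 1 + c * r^-1 = (r + c) / r.
  by near=> r; rewrite mulrDl mulfV // gt_eqF //; near: r; exact: nbhs_pinfty_gt.
apply: cvg_trans (near_eq_cvg ratioE) _.
rewrite -[1 in X in _ `=>` X]addr0 -[0](mulr0 c); apply: cvgD; first exact: cvg_cst.
apply: cvgMl_tmp; apply/gtr0_cvgV0; last exact: cvg_id.
exact: nbhs_pinfty_gt.
Unshelve. all: by end_near. Qed.

Section EuclideanBall.
Variables (R : realType) (k : nat).
Implicit Types (x y : 'rV[R]_k) (r s D : R).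

Definition enorm x : R := Num.sqrt (\sum_(i < k) x ord0 i ^+ 2).

Lemma enorm_ge0 x : 0 <= enorm x.
Proof. exact: sqrtr_ge0. Qed.

Lemma sqr_enorm x : enorm x ^+ 2 = \sum_(i < k) x ord0 i ^+ 2.
Proof. by rewrite sqr_sqrtr // sumr_ge0 // => i _; exact: sqr_ge0. Qed.

Lemma enormZ (l : R) x : enorm (l *: x) = `|l| * enorm x.
Proof.
rewrite -sqrtr_sqr -sqrtrM ?sqr_ge0 // mulr_sumr; congr Num.sqrt.
by apply: eq_bigr => i _; rewrite mxE exprMn.
Qed.

Lemma enormN x : enorm (- x) = enorm x.
Proof. by rewrite -scaleN1r enormZ normrN1 mul1r. Qed.

Lemma coord_norm_le_enorm x i : `|x ord0 i| <= enorm x.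
Proof.
rewrite -(@ler_pXn2r _ 2) ?nnegrE ?enorm_ge0 // sqr_enorm real_normK ?num_real //.
by rewrite (bigD1 i) //= lerDl sumr_ge0 // => j _; exact: sqr_ge0.
Qed.

Lemma norm_le_enorm x : `|x| <= enorm x.
Proof. by apply/rV_norm_leP => [|i]; [exact: enorm_ge0|exact: coord_norm_le_enorm]. Qed.

Lemma enorm_le_norm x : enorm x <= k%:R * `|x|.
Proof.
have n0 := normr_ge0 x.
rewrite -(@ler_pXn2r _ 2) ?nnegrE ?enorm_ge0 ?mulr_ge0 // sqr_enorm.
apply: (@le_trans _ _ (\sum_(i < k) `|x| ^+ 2)).
  apply: ler_sum => i _; rewrite -real_normK ?num_real //.
  by rewrite ler_pXn2r ?nnegrE // coord_norm_le.
rewrite sumr_const card_ord -[in leLHS]mulr_natl exprMn ler_wpM2r ?sqr_ge0 //.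
by rewrite -natrX ler_nat; case: (k) => // j; rewrite expnS leq_pmulr.
Qed.

Lemma cauchy_schwarz_enorm x y :
  \sum_(i < k) x ord0 i * y ord0 i <= enorm x * enorm y.
Proof.
have enorm0 z i : enorm z = 0 -> z ord0 i = 0.
  by move=> z0; apply/eqP; rewrite -normr_le0 -z0 coord_norm_le_enorm.
have [x0|x_neq0] := eqVneq (enorm x) 0.
  by rewrite x0 mul0r big1 // => i _; rewrite (enorm0 x) ?mul0r.
have [y0|y_neq0] := eqVneq (enorm y) 0.
  by rewrite y0 mulr0 big1 // => i _; rewrite (enorm0 y) ?mulr0.
have xy_gt0 : 0 < enorm x * enorm y by rewrite mulr_gt0 // lt_def enorm_ge0 ?x_neq0 ?y_neq0.
have : 0 <= \sum_(i < k) (enorm y * x ord0 i - enorm x * y ord0 i) ^+ 2.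
  by apply: sumr_ge0 => i _; exact: sqr_ge0.
have -> : \sum_(i < k) (enorm y * x ord0 i - enorm x * y ord0 i) ^+ 2 =
    2 * (enorm x * enorm y) * (enorm x * enorm y - \sum_(i < k) x ord0 i * y ord0 i).
  rewrite mulrBr (_ : 2 * (enorm x * enorm y) * (enorm x * enorm y) =
    enorm y ^+ 2 * enorm x ^+ 2 + enorm x ^+ 2 * enorm y ^+ 2); last by ring.
  rewrite {1}[enorm x ^+ 2]sqr_enorm {2}[enorm y ^+ 2]sqr_enorm !mulr_sumr.
  by rewrite -big_split /= -sumrB; apply: eq_bigr => i _; ring.
by rewrite pmulr_rge0 ?subr_ge0 // mulr_gt0.
Qed.

Lemma enormD x y : enorm (x + y) <= enorm x + enorm y.
Proof.
rewrite -(@ler_pXn2r _ 2) ?nnegrE ?addr_ge0 ?enorm_ge0 // sqr_enorm sqrrD !sqr_enorm.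
under eq_bigr do rewrite mxE sqrrD.
by rewrite !big_split /= lerD2r lerD2l -mulr2n lerMn2r cauchy_schwarz_enorm.
Qed.

Lemma eball_sub r d x y : eball r x -> enorm (y - x) <= d -> eball (r + d) y.
Proof.
move=> xr yx; rewrite -(subrK x y) [_ + x]addrC.
exact: le_lt_trans (enormD _ _) (ltr_leD xr yx).
Qed.

Lemma bounded_eball r : bounded_set (@eball R k r).
Proof.
apply/bounded_setP; exists (1 + `|r|); first by rewrite ltr_pwDl.
move=> x /ltW xr; apply: le_trans (norm_le_enorm x) _; apply: le_trans xr _.
by rewrite (le_trans (ler_norm r)) // lerDr.
Qed.

Lemma outer_eball_sub s r : 0 < s ->
  outer s (@eball R k r) `<=` inner s (eball (r + k%:R * s)).
Proof.
move=> s0 a [x [ax xr]] y ay; apply: eball_sub xr _.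
apply: le_trans (enorm_le_norm _) _; rewrite ler_wpM2l //.
exact/ltW/(cube_dist s0 ay ax).
Qed.

Hypothesis k_gt0 : (0 < k)%N.

Lemma vol_eball r : 0 < r -> vol (@eball R k r) = r ^+ k * vol (@eball R k 1).
Proof.
move=> r0; rewrite -[LHS]/(fine (leb_vol (eball r))).
have -> : @eball R k r = [set 0 + r *: x | x in eball 1].
  apply/seteqP; split=> [x xr|_ [x x1 <-]]; last first.
    by rewrite /eball /= -/(enorm _) add0r enormZ gtr0_norm // gtr_pMr.
  exists (r^-1 *: x); last by rewrite add0r scalerA mulfV ?gt_eqF // scale1r.
  by rewrite /eball /= -/(enorm _) enormZ gtr0_norm ?invr_gt0 // ltr_pdivrMl // mulr1.
rewrite leb_vol_homothety // (volE k_gt0) //; exact: bounded_eball.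
Qed.

Lemma vol_unit_eball_gt0 : 0 < vol (@eball R k 1).
Proof.
pose c : R := k.+1%:R^-1; have c0 : 0 < c by rewrite invr_gt0 ltr0n.
rewrite -lte_fin -volE //; last exact: bounded_eball.
apply: (@lt_le_trans _ _ (c ^+ k)%:E); first by rewrite lte_fin exprn_gt0.
have := @leb_vol_ge_boxes R k unit [:: tt] (fun=> 0) (fun=> 0 + const_mx c) (eball 1).
rewrite big_seq1 box_vol_cube ?(ltW c0) //; apply => //.
  by move=> [] [].
move=> x [_ _ xc]; apply: le_lt_trans (enorm_le_norm x) _.
have xc_le : `|x| <= c.
  apply/rV_norm_leP => [|i]; first exact: ltW.
  by have := xc i; rewrite !mxE add0r => -[x0 /ltW xi]; rewrite ger0_norm.
apply: le_lt_trans (ler_wpM2l (ler0n _ _) xc_le) _.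
by rewrite ltr_pdivrMr ?ltr0n // mul1r ltr_nat.
Qed.

Lemma vol_eball_gt0 r : 0 < r -> 0 < vol (@eball R k r).
Proof. by move=> r0; rewrite vol_eball // mulr_gt0 ?exprn_gt0 ?vol_unit_eball_gt0. Qed.

Lemma vol_eball_ratio_cvg (c : R) :
  vol (@eball R k (r + c)) / vol (@eball R k r) @[r --> +oo] --> (1 : R).
Proof.
apply: cvg_trans (cvgy_shift_ratio c k); apply: near_eq_cvg; near=> r.
have r0 : 0 < r by near: r; exact: nbhs_pinfty_gt.
have rc0 : 0 < r + c by rewrite -(opprK c) subr_gt0; near: r;
    exact: (nbhs_pinfty_gt (num_real _)).
rewrite (vol_eball rc0) (vol_eball r0) [_ ^+ k * vol _]mulrC [r ^+ k * _]mulrC -mulf_div mulfV.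
  by rewrite mul1r expr_div_n.
by rewrite gt_eqF ?vol_unit_eball_gt0.
Unshelve. all: by end_near. Qed.

Lemma vol_eball_le_inner s r D (T : set 'rV[R]_k) : 0 < s -> bounded_set T ->
  eball (r - D) `<=` T ->
  vol (@eball R k (r - (D + k%:R * s))) <= (set_card (inner s T))%:R * s ^+ k.
Proof.
move=> s0 T_bounded subT; apply: le_trans (vol_le_outer k_gt0 s0 (@bounded_eball _)) _.
rewrite ler_wpM2r ?exprn_ge0 ?(ltW s0) // ler_nat.
apply: subset_set_card; first exact: finite_inner.
apply: subset_trans (outer_eball_sub s0) _.
by rewrite opprD addrA subrK => a /subset_trans; exact.
Qed.

Lemma outer_le_vol_eball s r D (T : set 'rV[R]_k) : 0 < s -> T `<=` eball (r + D) ->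
  (set_card (outer s T))%:R * s ^+ k <= vol (@eball R k (r + (D + k%:R * s))).
Proof.
move=> s0 Tsub; apply: le_trans (inner_le_vol k_gt0 s0 (@bounded_eball _)).
rewrite ler_wpM2r ?exprn_ge0 ?(ltW s0) // ler_nat.
apply: subset_set_card; first by apply: finite_inner => //; exact: bounded_eball.
rewrite addrA; apply: subset_trans (outer_eball_sub s0) => a [x [ax /Tsub Tx]].
by exists x.
Qed.

Definition van_hove (T : R -> set 'rV[R]_k) (v : R -> R) :=
  [/\ \forall r \near +oo, bounded_set (T r), \forall r \near +oo, 0 < v r,
      forall s, 0 < s ->
        (set_card (outer s (T r)))%:R * s ^+ k / v r @[r --> +oo] --> (1 : R)
    & forall s, 0 < s ->
        (set_card (inner s (T r)))%:R * s ^+ k / v r @[r --> +oo] --> (1 : R)].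

Lemma van_hove_eball D (T : R -> set 'rV[R]_k) :
  (\forall r \near +oo, eball (r - D) `<=` T r /\ T r `<=` eball (r + D)) ->
  van_hove T (fun r => vol (@eball R k r)).
Proof.
move=> T_near.
have T_bounded : \forall r \near +oo, bounded_set (T r).
  by apply: filterS T_near => r [_ /sub_bounded_set]; apply; exact: bounded_eball.
have v_gt0 : \forall r \near +oo, 0 < vol (@eball R k r).
  by near=> r; apply: vol_eball_gt0; near: r; exact: nbhs_pinfty_gt.
have counts s : 0 < s -> \forall r \near +oo,
    let inner_r := (set_card (inner s (T r)))%:R * s ^+ k / vol (@eball R k r) in
    let outer_r := (set_card (outer s (T r)))%:R * s ^+ k / vol (@eball R k r) in
    [/\ vol (@eball R k (r - (D + k%:R * s))) / vol (@eball R k r) <= inner_r,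
        inner_r <= outer_r &
        outer_r <= vol (@eball R k (r + (D + k%:R * s))) / vol (@eball R k r)].
  move=> s0; near=> r.
  have [subT Tsub] : eball (r - D) `<=` T r /\ T r `<=` eball (r + D) by near: r.
  have bT : bounded_set (T r) by near: r.
  have vr : 0 < vol (@eball R k r) by near: r.
  rewrite /= !ler_pM2r ?invr_gt0 // ?exprn_gt0 // ler_nat; split.
  - exact: vol_eball_le_inner.
  - exact: inner_card_le_outer.
  - exact: outer_le_vol_eball.
split=> // s s0; apply: squeeze_cvgr (vol_eball_ratio_cvg (- (D + k%:R * s)))
    (vol_eball_ratio_cvg (D + k%:R * s)); apply: filterS (counts s s0) => r [lb mid ub].
  by rewrite (le_trans lb mid) ub.
by rewrite lb (le_trans mid ub).
Unshelve. all: by end_near. Qed.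

End EuclideanBall.

(** * The lattice *)

Section MatrixNorm.
Variable R : realType.

Lemma norm_lsubmx_le n m (x : 'rV[R]_(n + m)) : `|lsubmx x| <= `|x|.
Proof. by apply/rV_norm_leP => // i; rewrite mxE; exact: coord_norm_le. Qed.

Lemma norm_rsubmx_le n m (x : 'rV[R]_(n + m)) : `|rsubmx x| <= `|x|.
Proof. by apply/rV_norm_leP => // i; rewrite mxE; exact: coord_norm_le. Qed.

Lemma norm_row_mx_le n m (x : 'rV[R]_n) (y : 'rV[R]_m) :
  `|row_mx x y| <= Num.max `|x| `|y|.
Proof.
apply/rV_norm_leP => [|i]; first by rewrite le_max normr_ge0.
by case: (split_ordP i) => j ->; rewrite ?row_mxEl ?row_mxEr le_max coord_norm_le ?orbT.
Qed.

Lemma mulmx_norm_bound k l (A : 'M[R]_(k, l)) :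
  exists2 C, 0 < C & forall x : 'rV[R]_k, `|x *m A| <= C * `|x|.
Proof.
pose C := 1 + \sum_i \sum_j `|A i j|.
have C0 : 0 < C by rewrite ltr_pwDl // !sumr_ge0 // => i _; rewrite sumr_ge0.
exists C => // x; apply/rV_norm_leP => [|j]; first by rewrite mulr_ge0 // ltW.
rewrite mxE; apply: le_trans (ler_norm_sum _ _ _) _.
apply: (@le_trans _ _ (\sum_i (\sum_j `|A i j|) * `|x|)); last first.
  by rewrite -mulr_suml ler_wpM2r // lerDr.
apply: ler_sum => i _; rewrite normrM mulrC ler_pM ?coord_norm_le //.
by rewrite (bigD1 j) //= lerDl sumr_ge0.
Qed.

End MatrixNorm.

Section Lattice.
Variables (R : realType) (n m : nat) (B : 'M[R]_(n + m)).
Implicit Types (z : 'rV[int]_(n + m)) (T : set 'rV[R]_n) (A : set 'rV[R]_m).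

Definition embed z : 'rV[R]_(n + m) := map_mx intr z *m B.
Definition direct z : 'rV[R]_n := lsubmx (embed z).
Definition internal z : 'rV[R]_m := rsubmx (embed z).

Fact direct_is_zmod_morphism : zmod_morphism direct.
Proof. by move=> z w; rewrite /direct /embed map_mxB mulmxBl raddfB. Qed.

Fact internal_is_zmod_morphism : zmod_morphism internal.
Proof. by move=> z w; rewrite /internal /embed map_mxB mulmxBl raddfB. Qed.

HB.instance Definition _ := GRing.isZmodMorphism.Build _ _ direct direct_is_zmod_morphism.
HB.instance Definition _ :=
  GRing.isZmodMorphism.Build _ _ internal internal_is_zmod_morphism.

Definition lattice_points T A := direct @^-1` T `&` internal @^-1` A.

Hypothesis B_unit : B \in unitmx.

Lemma embed_inj : injective embed.
Proof.
move=> z w /(congr1 (mulmx^~ (invmx B))); rewrite /embed !mulmxK // => /rowP zw.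
by apply/rowP => i; have := zw i; rewrite !mxE => /intr_inj.
Qed.

Lemma finite_lattice_points T A : bounded_set T -> bounded_set A ->
  finite_set (lattice_points T A).
Proof.
move=> /bounded_setP[M1 M10 TM1] /bounded_setP[M2 M20 AM2].
have [C C0 invB_le] := mulmx_norm_bound (invmx B); pose M := C * Num.max M1 M2.
apply: sub_finite_set (finite_grid_points (const_mx (- M)) (const_mx (M + 1)) ltr01).
move=> z [Tz Az] i; rewrite scale1r.
have : `|map_mx intr z : 'rV[R]__| <= M.
  have -> : map_mx intr z = row_mx (direct z) (internal z) *m invmx B.
    by rewrite hsubmxK /embed mulmxK.
  apply: le_trans (invB_le _) _; rewrite ler_wpM2l ?(ltW C0) //.
  by apply: le_trans (norm_row_mx_le _ _) _; rewrite ge_max !le_max TM1 // AM2 // orbT.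
move=> /(le_trans (coord_norm_le _ i)); rewrite ler_norml [const_mx _ _ _]mxE.
by rewrite [const_mx (M + 1) _ _]mxE => /andP[? ?]; split=> //; lra.
Qed.

Lemma lattice_cocompact : exists2 M, 0 < M & forall (u : 'rV[R]_n) (v : 'rV[R]_m),
  exists2 z, `|direct z - u| <= M & `|internal z - v| <= M.
Proof.
have [C C0 B_le] := mulmx_norm_bound B; exists C => // u v.
pose x := row_mx u v *m invmx B.
pose z : 'rV[int]_(n + m) := \row_i Num.floor (x ord0 i).
have embed_near : `|embed z - row_mx u v| <= C.
  have -> : embed z - row_mx u v = (map_mx intr z - x) *m B by rewrite mulmxBl mulmxKV.
  apply: le_trans (B_le _) _; rewrite -[leRHS]mulr1 ler_wpM2l ?(ltW C0) //.
  apply/rV_norm_leP => // i; rewrite !mxE -/x; have /andP[] := floor_itv (x ord0 i).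
  by rewrite intrD ler_norml mxE => ? ?; apply/andP; split; lra.
exists z; apply: le_trans embed_near.
  by apply: le_trans (norm_lsubmx_le _); rewrite raddfB /= row_mxKl.
by apply: le_trans (norm_rsubmx_le _); rewrite raddfB /= row_mxKr.
Qed.

Hypothesis B_dense : dense [set rsubmx x | x in lattice B].

Lemma internal_dense (v : 'rV[R]_m) (e : R) : 0 < e -> exists z, `|internal z - v| < e.
Proof.
move=> e0; have [||x [vx [_ [z _ <-] zx]]] := @B_dense (ball v e).
- by exists v; exact: ballxx.
- exact: ball_open.
- by exists z; move: vx; rewrite -zx -ball_normE /= distrC.
Qed.

(* By cocompactness only the targets v of a compact cube matter, and there finitely many
   lattice points suffice; hence the bound C on the direct side is uniform in v. *)
Lemma lattice_approx (e : R) : 0 < e -> exists2 C, 0 < C &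
  forall (u : 'rV[R]_n) (v : 'rV[R]_m),
    exists2 z, `|direct z - u| <= C & `|internal z - v| <= e.
Proof.
move=> e0; have [M M0 cocompact] := lattice_cocompact.
pose Q : set 'rV[R]_m := [set v | forall i, `[- M, M]%classic (v ord0 i)].
have Q_compact : compact Q.
  by apply: (@rV_compact R m (fun=> `[- M, M]%classic)) => _; exact: segment_compact.
have : \forall C \near +oo,
    Q `<=` [set v | exists2 z, `|direct z| <= C & `|internal z - v| <= e].
  apply: (compact_near_coveringP Q).1 => // v _.
  have e20 : 0 < e / 2 by rewrite divr_gt0.
  have [z zv] := internal_dense v e20.
  exists (ball v (e / 2), [set C | `|direct z| <= C]) => /=.
    by split; [exact: nbhsx_ballx|exact: nbhs_pinfty_ge].
  move=> [v' C] /= [vv' zC]; exists z => //; rewrite (splitr e).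
  rewrite -(subrKA v) (le_trans (ler_normD _ _)) // lerD ?(ltW zv) //.
  by move: vv'; rewrite -ball_normE => /ltW.
move=> /pinfty_ex_gt0[C C0 Q_approx]; exists (C + M); first by rewrite addr_gt0.
move=> u v; have [z zu zv] := cocompact u v.
have [|w wC wv] := Q_approx (v - internal z).
  move=> i; have := le_trans (coord_norm_le _ i) zv.
  by rewrite /= in_itv /= ler_norml !mxE => /andP[? ?]; apply/andP; split; lra.
exists (w + z); rewrite raddfD /=.
  by rewrite -addrA (le_trans (ler_normD _ _)) // lerD.
by move: wv; rewrite opprB addrA.
Qed.

End Lattice.

(** * Equidistribution of lattice points *)

Section CountingByCubes.
Variables (R : realType) (k : nat) (U : choiceType).
Variables (Z : set U) (f : U -> 'rV[R]_k) (A : set 'rV[R]_k) (h : R).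
Hypotheses (A_bounded : bounded_set A) (h_gt0 : 0 < h).

Let Z_in (C : set 'rV[R]_k) := set_card (Z `&` f @^-1` C).

Lemma card_le_sum_outer : (forall a, finite_set (Z `&` f @^-1` cube (corner h a) h)) ->
  (Z_in A <= \sum_(a <- fset_set (outer h A)) Z_in (cube (corner h a) h))%N.
Proof.
move=> fin; apply: set_card_le_cover => [a _|x [Zx Afx]]; first exact: fin.
rewrite fset_setK; last exact: finite_outer.
by have [a aA fxa] := outer_cover h_gt0 Afx; exists a.
Qed.

Lemma sum_inner_le_card : finite_set (Z `&` f @^-1` A) ->
  (\sum_(a <- fset_set (inner h A)) Z_in (cube (corner h a) h) <= Z_in A)%N.
Proof.
move=> fin; have fin_inner := finite_inner h_gt0 A_bounded.
apply: set_card_ge_packing; rewrite ?fset_uniq // fset_setK //.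
  move=> a b aA bA [x [[_ xa] [_ xb]]].
  by apply: (trivIset_cube h_gt0 aA bA); exists (f x).
by move=> x [a aA [Zx xa]]; split=> //; exact: aA.
Qed.

Lemma card_le_outer (v : R) : (forall a, finite_set (Z `&` f @^-1` cube (corner h a) h)) ->
  (forall a, (Z_in (cube (corner h a) h))%:R <= v) ->
  (Z_in A)%:R <= (set_card (outer h A))%:R * v.
Proof.
move=> fin Zv; have := card_le_sum_outer fin; rewrite -(ler_nat R) natr_sum.
move=> /le_trans; apply; rewrite mulr_natl -sumr_const_set_card.
by apply: ler_sum => a _.
Qed.

Lemma inner_le_card (v : R) : finite_set (Z `&` f @^-1` A) ->
  (forall a, v <= (Z_in (cube (corner h a) h))%:R) ->
  (set_card (inner h A))%:R * v <= (Z_in A)%:R.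
Proof.
move=> fin vZ; have := sum_inner_le_card fin; rewrite -(ler_nat R) natr_sum.
apply: le_trans; rewrite mulr_natl -sumr_const_set_card.
by apply: ler_sum => a _.
Qed.

End CountingByCubes.

Lemma cvg_approx_squeeze (R : realType) (T : Type) (F : set_system T) {FF : Filter F}
    (f : T -> R) (l : R) :
  (forall e, 0 < e -> exists lo hi : T -> R, exists a b : R,
    [/\ lo @ F --> a, hi @ F --> b, l - e < a, b < l + e &
        \forall t \near F, lo t <= f t <= hi t]) ->
  f @ F --> l.
Proof.
move=> approx; apply/cvgrPdist_lt => e /approx[lo [hi [a [b [lo_a hi_b la bl lofhi]]]]].
near=> t; have /andP[lof fhi] : lo t <= f t <= hi t by near: t.
have lot : l - e < lo t by near: t; exact: cvgr_gt lo_a _ la.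
have hit : hi t < l + e by near: t; exact: cvgr_lt hi_b _ bl.
by rewrite ltr_norml; apply/andP; split; lra.
Unshelve. all: by end_near. Qed.

Section Equidistribution.
Variables (R : realType) (n m : nat) (B : 'M[R]_(n + m)).
Hypotheses (n_gt0 : (0 < n)%N) (m_gt0 : (0 < m)%N).
Hypotheses (B_unit : B \in unitmx) (B_dense : dense [set rsubmx x | x in lattice B]).
Implicit Types (s h r : R) (x : 'rV[R]_n) (y : 'rV[R]_m).
Implicit Types (T : set 'rV[R]_n) (A : set 'rV[R]_m).

Definition cell_card s h x y : nat := set_card (lattice_points B (cube x s) (cube y h)).

Lemma finite_cell s h x y : finite_set (lattice_points B (cube x s) (cube y h)).
Proof. by apply: finite_lattice_points => //; exact: bounded_box. Qed.

(* Translating by a lattice vector moves any cell into any slightly larger one. *)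
Lemma cell_card_compare (e : R) : 0 < e -> exists2 C, 0 < C &
  forall s h x y x' y', (cell_card s h x y <= cell_card (s + 2 * C) (h + 2 * e) x' y')%N.
Proof.
move=> e0; have [C C0 approx] := lattice_approx B_unit B_dense e0.
exists C => // s h x y x' y'.
have [z zx zy] := approx (x' - x + const_mx C) (y' - y + const_mx e).
have shift_cube k (u u' : 'rV[R]_k) (c l : R) (p q : 'rV[R]_k) :
    `|q - (u' - u + const_mx c)| <= c -> cube u l p -> cube u' (l + 2 * c) (p + q).
  move=> qc up i; have := le_trans (coord_norm_le _ i) qc; have := up i.
  by rewrite !mxE ler_norml => -[? ?] /andP[? ?]; split; lra.
rewrite /cell_card -(@set_card_image _ _ (+%R^~ z)); last 2 first.
- exact: finite_cell.
- by move=> w w' _ _; exact: addIr.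
apply: subset_set_card; first exact: finite_cell.
move=> _ [w [wx wy] <-].
by split; rewrite /preimage /= raddfD; [exact: shift_cube zx wx|exact: shift_cube zy wy].
Qed.

Lemma lattice_card_le T A s h (v : R) : bounded_set T -> bounded_set A ->
  0 < s -> 0 < h -> (forall x y, (cell_card s h x y)%:R <= v) ->
  (set_card (lattice_points B T A))%:R <=
    (set_card (outer s T))%:R * ((set_card (outer h A))%:R * v).
Proof.
move=> bT bA s0 h0 cell_v; rewrite /lattice_points setIC.
apply: card_le_outer => // a; rewrite setIC.
  by apply: finite_lattice_points => //; exact: bounded_box.
by apply: card_le_outer => // b; [exact: finite_cell|exact: cell_v].
Qed.

Lemma lattice_card_ge T A s h (v : R) : bounded_set T -> bounded_set A ->
  0 < s -> 0 < h -> (forall x y, v <= (cell_card s h x y)%:R) ->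
  (set_card (inner s T))%:R * ((set_card (inner h A))%:R * v) <=
    (set_card (lattice_points B T A))%:R.
Proof.
move=> bT bA s0 h0 cell_v; rewrite /lattice_points setIC.
apply: inner_le_card => // [|a]; rewrite setIC; first exact: finite_lattice_points.
apply: inner_le_card => // [|b]; last exact: cell_v.
by apply: finite_lattice_points => //; exact: bounded_box.
Qed.

(* As in Fekete's lemma: every lower bound on cells is compared with every upper bound by
   counting the points of a large product of balls with both kinds of cells. *)
Lemma cell_card_ratio_le s h (v : R) s' h' (v' : R) : 0 < s -> 0 < h -> 0 < s' -> 0 < h' ->
  (forall x y, v <= (cell_card s h x y)%:R) ->
  (forall x y, (cell_card s' h' x y)%:R <= v') ->
  v / (s ^+ n * h ^+ m) <= v' / (s' ^+ n * h' ^+ m).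
Proof.
move=> s0 h0 s'0 h'0 vle lev'.
have eball_vh k (k_gt0 : (0 < k)%N) : van_hove (@eball R k) (fun r => vol (@eball R k r)).
  by apply: (@van_hove_eball _ _ k_gt0 0); near=> r; rewrite subr0 addr0; split.
have [_ Vn outer_n inner_n] := eball_vh n n_gt0.
have [_ Vm outer_m inner_m] := eball_vh m m_gt0.
have scaled_cvg (f g : R -> R) (c : R) : f r @[r --> +oo] --> (1 : R) ->
    g r @[r --> +oo] --> (1 : R) -> f r * g r * c @[r --> +oo] --> c.
  have one_c : 1 * 1 * c = c by rewrite !mul1r.
  by move=> f1 g1; rewrite -[X in _ --> X]one_c; exact: cvgMr_tmp (cvgM f1 g1).
apply: (ler_cvg_to (scaled_cvg _ _ (v / (s ^+ n * h ^+ m)) (inner_n s s0) (inner_m h h0))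
  (scaled_cvg _ _ (v' / (s' ^+ n * h' ^+ m)) (outer_n s' s'0) (outer_m h' h'0))).
near=> r; have Vnr : 0 < vol (@eball R n r) by near: r.
have Vmr : 0 < vol (@eball R m r) by near: r.
have lower := lattice_card_ge (@bounded_eball R n r) (@bounded_eball R m r) s0 h0 vle.
have upper := lattice_card_le (@bounded_eball R n r) (@bounded_eball R m r) s'0 h'0 lev'.
have regroup (a b c d e p q : R) : d != 0 -> e != 0 -> p != 0 -> q != 0 ->
    a * d / p * (b * e / q) * (c / (d * e)) = a * (b * c) / (p * q) by
      move=> d0 e0 p0 q0; field; rewrite d0 e0 p0 q0.
rewrite !regroup ?expf_neq0 ?gt_eqF // ler_pM2r ?invr_gt0 ?mulr_gt0 //.
exact: le_trans lower upper.
Unshelve. all: by end_near. Qed.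

Definition density : R := inf [set d | exists s h v,
  [/\ 0 < s, 0 < h, forall x y, (cell_card s h x y)%:R <= v & d = v / (s ^+ n * h ^+ m)]].

Let cell_vol_gt0 s h : 0 < s -> 0 < h -> 0 < s ^+ n * h ^+ m.
Proof. by move=> s0 h0; rewrite mulr_gt0 ?exprn_gt0. Qed.

Lemma density_le s h (v : R) : 0 < s -> 0 < h ->
  (forall x y, (cell_card s h x y)%:R <= v) -> density * (s ^+ n * h ^+ m) <= v.
Proof.
move=> s0 h0 lev; rewrite -ler_pdivlMr ?cell_vol_gt0 //; apply: ge_inf; last by exists s, h, v.
exists 0 => _ [s' [h' [v' [s'0 h'0 lev' ->]]]].
by rewrite divr_ge0 ?(ltW (cell_vol_gt0 _ _)) //; exact: le_trans (lev' 0 0).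
Qed.

Lemma density_ge s h (v : R) : 0 < s -> 0 < h ->
  (forall x y, v <= (cell_card s h x y)%:R) -> v <= density * (s ^+ n * h ^+ m).
Proof.
move=> s0 h0 vle; rewrite -ler_pdivrMr ?cell_vol_gt0 //; apply: lb_le_inf.
  have [C C0 compare] := cell_card_compare ltr01.
  pose v' : R := (cell_card (1 + 2 * C) (1 + 2 * 1) 0 0)%:R.
  by exists (v' / (1 ^+ n * 1 ^+ m)), 1, 1, v'; split=> // x y; rewrite ler_nat.
by move=> _ [s' [h' [v' [s'0 h'0 lev' ->]]]]; exact: cell_card_ratio_le.
Qed.

Lemma density_gt0 : 0 < density.
Proof.
have [C C0 approx] := lattice_approx B_unit B_dense (@ltr01 R).
have s0 : 0 < 2 * C + 1 by rewrite addr_gt0 // mulr_gt0.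
have h0 : (0 : R) < 3 by [].
rewrite -(pmulr_lgt0 _ (cell_vol_gt0 s0 h0)); apply: (@lt_le_trans _ _ 1) => //.
apply: density_ge => // x y.
have [z zx zy] := approx (x + const_mx C) (y + const_mx 1).
have mem_cube k (u p : 'rV[R]_k) (c l : R) : 2 * c < l -> `|p - (u + const_mx c)| <= c ->
    cube u l p.
  move=> cl pu i; have := le_trans (coord_norm_le _ i) pu.
  by rewrite !mxE ler_norml => /andP[? ?]; split; lra.
have z_cell : lattice_points B (cube x (2 * C + 1)) (cube y 3) z.
  by split; [apply: mem_cube zx|apply: mem_cube zy]; lra.
rewrite ler1n cardfs_gt0; apply/fset0Pn; exists z.
by rewrite in_fset_set ?inE //; exact: finite_cell.
Qed.

Lemma cell_card_bounds (e : R) : 0 < e -> exists2 C, 0 < C &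
  (forall s h x y, 0 < s -> 0 < h ->
    (cell_card s h x y)%:R <= density * ((s + 2 * C) ^+ n * (h + 2 * e) ^+ m)) /\
  (forall s h x y, 2 * C < s -> 2 * e < h ->
    density * ((s - 2 * C) ^+ n * (h - 2 * e) ^+ m) <= (cell_card s h x y)%:R).
Proof.
move=> e0; have [C C0 compare] := cell_card_compare e0; exists C => //; split.
  move=> s h x y s0 h0; apply: density_ge; rewrite ?addr_gt0 ?mulr_gt0 // => x' y'.
  by rewrite ler_nat.
move=> s h x y Cs eh; apply: density_le; rewrite ?subr_gt0 // => x' y'; rewrite ler_nat.
by have := compare (s - 2 * C) (h - 2 * e) x' y' x y; rewrite !subrK.
Qed.

Lemma cell_card_uniform_cvg h (e : R) : 0 < h -> 0 < e ->
  \forall s \near +oo, forall x y, `|density * h ^+ m - (cell_card s h x y)%:R / s ^+ n| < e.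
Proof.
move=> h0 e0; set l := density * h ^+ m.
have h_cvg (c : R) : density * (h + c * d) ^+ m @[d --> 0^'+] --> l.
  have hE : h + c * 0 = h by rewrite mulr0 addr0.
  rewrite /l -[X in _ --> density * X ^+ m]hE; apply: cvgMl_tmp; apply: cvg_exprn.
  by apply: cvgD; [exact: cvg_cst|apply: cvgMl_tmp; exact: cvg_within].
have [d [d0 dh ub lb]] : exists d, [/\ 0 < d, 2 * d < h,
    density * (h + 2 * d) ^+ m < l + e & l - e < density * (h + - 2 * d) ^+ m].
  near (0 : R)^'+ => d; exists d; split=> //.
  - by rewrite -ltr_pdivlMl //; near: d; apply: nbhs_right_lt; rewrite mulr_gt0 ?invr_gt0.
  - by near: d; apply: cvgr_lt (h_cvg _) _ _; rewrite ltrDl.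
  - by near: d; apply: cvgr_gt (h_cvg _) _ _; rewrite gtrBl.
have [C C0 [card_le card_ge]] := cell_card_bounds d0.
have s_cvg (c a : R) : ((s + c) / s) ^+ n * a @[s --> +oo] --> a.
  by rewrite -[X in _ --> X]mul1r; apply: cvgMr_tmp; exact: cvgy_shift_ratio.
near=> s; have s0 : 0 < s by near: s; exact: nbhs_pinfty_gt.
have sC : 2 * C < s by near: s; exact: (nbhs_pinfty_gt (num_real _)).
have sn : 0 < s ^+ n by rewrite exprn_gt0.
have s_ub : ((s + 2 * C) / s) ^+ n * (density * (h + 2 * d) ^+ m) < l + e.
  by near: s; exact: cvgr_lt (s_cvg _ _) _ ub.
have s_lb : l - e < ((s - 2 * C) / s) ^+ n * (density * (h - 2 * d) ^+ m).
  by near: s; apply: cvgr_gt (s_cvg _ _) _ _; rewrite -mulNr.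
move=> x y; rewrite distrC ltr_distl; apply/andP; split.
  rewrite ltr_pdivlMr //; apply: lt_le_trans (card_ge s h x y sC dh).
  by move: s_lb; rewrite -(ltr_pM2r sn) expr_div_n mulrAC divfK ?gt_eqF // mulrCA.
rewrite ltr_pdivrMr //; apply: le_lt_trans (card_le s h x y s0 h0) _.
by move: s_ub; rewrite -(ltr_pM2r sn) expr_div_n mulrAC divfK ?gt_eqF // mulrCA.
Unshelve. all: by end_near. Qed.

Lemma cube_equidistribution (T : R -> set 'rV[R]_n) (v : R -> R) h y :
  van_hove T v -> 0 < h ->
  (set_card (lattice_points B (T r) (cube y h)))%:R / v r @[r --> +oo] --> density * h ^+ m.
Proof.
move=> [T_bounded v_gt0 outer_cvg inner_cvg] h0; set l := density * h ^+ m.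
apply: cvg_approx_squeeze => e e0; have e20 : 0 < e / 2 by rewrite divr_gt0.
have [s [s0 card_s]] := filter_ex (filterI (nbhs_pinfty_gt (num_real 0))
  (cell_card_uniform_cvg h0 e20)).
have sn : 0 < s ^+ n by rewrite exprn_gt0.
pose ratio (D : R -> set 'rV[int]_n) r := (set_card (D r))%:R * s ^+ n / v r.
exists (fun r => ratio (fun r => inner s (T r)) r * (l - e / 2)).
exists (fun r => ratio (fun r => outer s (T r)) r * (l + e / 2)).
exists (1 * (l - e / 2)), (1 * (l + e / 2)); rewrite !mul1r; split.
- by rewrite -[X in _ --> X]mul1r; apply: cvgMr_tmp; exact: inner_cvg.
- by rewrite -[X in _ --> X]mul1r; apply: cvgMr_tmp; exact: outer_cvg.
- lra.
- lra.
near=> r; have vr : 0 < v r by near: r.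
have bT : bounded_set (T r) by near: r.
have card_lb x : s ^+ n * (l - e / 2) <= (cell_card s h x y)%:R.
  have := card_s x y; rewrite distrC ltr_distl => /andP[/ltW + _].
  by rewrite ler_pdivlMr // mulrC.
have card_ub x : (cell_card s h x y)%:R <= s ^+ n * (l + e / 2).
  have := card_s x y; rewrite distrC ltr_distl => /andP[_ /ltW].
  by rewrite ler_pdivrMr // mulrC.
rewrite /ratio ![_ / v r * _]mulrAC !ler_pM2r ?invr_gt0 // -!mulrA /lattice_points setIC.
apply/andP; split.
  apply: inner_le_card => // [|a]; rewrite setIC; last exact: card_lb.
  by apply: finite_lattice_points => //; exact: bounded_box.
by apply: card_le_outer => // a; rewrite setIC; [exact: finite_cell|exact: card_ub].
Unshelve. all: by end_near. Qed.

Theorem equidistribution (T : R -> set 'rV[R]_n) (v : R -> R) A :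
  van_hove T v -> jordan_measurable A ->
  (set_card (lattice_points B (T r) A))%:R / v r @[r --> +oo] --> density * vol A.
Proof.
move=> T_vh [bA outer_cvg inner_cvg]; have [T_bounded v_gt0 _ _] := T_vh.
apply: cvg_approx_squeeze => e e0.
have [h [h0 [outer_h inner_h]]] : exists h, 0 < h /\
    (density * ((set_card (outer h A))%:R * h ^+ m) < density * vol A + e /\
    density * vol A - e < density * ((set_card (inner h A))%:R * h ^+ m)).
  near (0 : R)^'+ => h; exists h; split=> //; split; near: h.
    by apply: cvgr_lt (cvgMl_tmp outer_cvg) _ _; rewrite ltrDl.
  by apply: cvgr_gt (cvgMl_tmp inner_cvg) _ _; rewrite gtrBl.
pose card_in b r := (set_card (lattice_points B (T r) (cube (corner h b) h)))%:R / v r.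
have sum_cvg D : \sum_(b <- fset_set D) card_in b r @[r --> +oo] -->
    density * ((set_card D)%:R * h ^+ m).
  rewrite mulr_natl mulrnAr -sumr_const_set_card.
  by apply: cvg_big => [|b _]; [exact: add_continuous|exact: cube_equidistribution].
exists (fun r => \sum_(b <- fset_set (inner h A)) card_in b r).
exists (fun r => \sum_(b <- fset_set (outer h A)) card_in b r).
exists (density * ((set_card (inner h A))%:R * h ^+ m)).
exists (density * ((set_card (outer h A))%:R * h ^+ m)).
split=> //; near=> r; have vr : 0 < v r by near: r.
have bT : bounded_set (T r) by near: r.
rewrite -!mulr_suml !ler_pM2r ?invr_gt0 // -!natr_sum !ler_nat; apply/andP; split.
  by apply: sum_inner_le_card => //; exact: finite_lattice_points.
by apply: card_le_sum_outer => // b; apply: finite_lattice_points => //; exact: bounded_box.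
Unshelve. all: by end_near. Qed.

End Equidistribution.

(** * Covariograms *)

Section Overlap.
Variables (R : realType) (m : nat).
Hypothesis m_gt0 : (0 < m)%N.
Implicit Types (W : set 'rV[R]_m) (x y : 'rV[R]_m).

Definition overlap W y : set 'rV[R]_m := W `&` [set y + x | x in W].

Lemma overlapP W y x : overlap W y x <-> W x /\ W (x - y).
Proof.
split=> [[Wx [z Wz zx]]|[Wx Wxy]].
  by split=> //; rewrite -zx [y + z]addrC addrK.
by split=> //; exists (x - y); rewrite // subrKC.
Qed.

Lemma bounded_overlapping W : bounded_set W -> bounded_set [set y | overlap W y !=set0].
Proof.
move=> /bounded_setP[M M0 WM]; apply/bounded_setP; exists (M + M); first exact: addr_gt0.
move=> y [x /overlapP[/WM xM /WM xyM]].
by rewrite -(subKr x y) (le_trans (ler_normB _ _)) // lerD.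
Qed.

Variable W : set 'rV[R]_m.
Hypotheses (W_compact : compact W) (W_null : null_boundary W).

Lemma compact_overlap y : compact (overlap W y).
Proof.
apply: (compact_closedI W_compact).
by apply: compact_set_closed; exact: compact_translate.
Qed.

Lemma covariogramE y : covariogram W y = (vol (overlap W y))%:E.
Proof. by rewrite -volE //; apply: compact_bounded; exact: compact_overlap. Qed.

Lemma jordan_measurable_overlap y : jordan_measurable (overlap W y).
Proof.
apply: compact_jordan_measurable; [exact: m_gt0|exact: compact_overlap|].
apply: null_boundaryI => //; first exact: compact_translate.
exact: null_boundary_translate.
Qed.

Lemma overlap_sub_dilation y (d : R) : 0 < d ->
  \forall y' \near y, overlap W y' `<=` dilation d (overlap W y).
Proof.
move=> d0.
have : \forall y' \near y,
    W `<=` [set x | W (x - y') -> dilation d (overlap W y) x].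
  apply: ((compact_near_coveringP W).1 W_compact _ (nbhs y)
    (fun y' x => W (x - y') -> dilation d (overlap W y) x)) => x Wx.
  have [Wxy|nWxy] := pselect (W (x - y)).
    exists (ball x d, setT) => /=; first by split; [exact: nbhsx_ballx|exact: filterT].
    move=> [x' y'] /= [xx' _] _; exists x; first exact/overlapP.
    by move: xx'; rewrite -ball_normE /= distrC.
  have xyW : nbhs (x - y) (~` W).
    apply: open_nbhs_nbhs; split=> //; apply: closed_openC.
    exact: compact_set_closed.
  have /(_ _ xyW)[[P Q] /= [xP yQ] PQ] := @sub_continuous 'rV[R]_m (x, y).
  by exists (P, Q) => // -[x' y'] /= PQx'y' Wx'y'; have := PQ (x', y') PQx'y'.
by apply: filterS => y' W_dil x /overlapP[Wx Wxy']; exact: W_dil.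
Qed.

Lemma erosion_sub_overlap y y' (d : R) : `|y - y'| < d ->
  erosion d (overlap W y) `<=` overlap W y'.
Proof.
move=> yy' x x_ero; have d0 : 0 < d by exact: le_lt_trans yy'.
have /overlapP[Wx _] := erosion_sub d0 x_ero; apply/overlapP; split=> //.
have /overlapP[_] : overlap W y (x - y' + y); last by rewrite addrK.
by apply: x_ero; rewrite opprD addrA subKr distrC.
Qed.

Lemma vol_overlap_upper y (e : R) : 0 < e ->
  \forall y' \near y, vol (overlap W y') < vol (overlap W y) + e.
Proof.
move=> e0; have : (leb_vol (overlap W y) < (vol (overlap W y) + e)%:E)%E.
  by rewrite [X in (X < _)%E]covariogramE lte_fin ltrDl.
move=> /(compact_leb_vol_dilation m_gt0 (@compact_overlap y)).
move=> /(filterI (nbhs_right_gt 0))/filter_ex[d [d0 dil_lt]].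
apply: filterS (overlap_sub_dilation y d0) => y' sub.
by rewrite -lte_fin -covariogramE; exact: le_lt_trans (le_leb_vol sub) dil_lt.
Qed.

Lemma vol_overlap_lower y (e : R) : 0 < e ->
  \forall y' \near y, vol (overlap W y) - e < vol (overlap W y').
Proof.
move=> e0; have vol_gt : vol (overlap W y) - e < vol (overlap W y) by rewrite gtrBl.
have [d [d0 ero_gt]] := filter_ex (filterI (nbhs_right_gt 0)
  (jordan_erosion (@jordan_measurable_overlap y) vol_gt)).
apply/nbhs_ballP; exists d => // y'; rewrite -ball_normE /= => yy'.
rewrite -lte_fin -covariogramE; apply: lt_le_trans ero_gt _.
by apply: le_leb_vol; exact: erosion_sub_overlap.
Qed.

Lemma vol_overlap_continuous : continuous (fun y => vol (overlap W y)).
Proof.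
move=> y; apply/(cvgrPdist_lt (FF := nbhs_filter y)) => e e0.
apply: (filterS2 _ _ (vol_overlap_lower y e0) (vol_overlap_upper y e0)) => y' lower upper.
by rewrite ltr_norml; apply/andP; split; lra.
Qed.

End Overlap.

Lemma window_compact (R : realType) (m : nat) (W : set 'rV[R]_m) : window W -> compact W.
Proof. by case. Qed.

Lemma window_null_boundary (R : realType) (m : nat) (W : set 'rV[R]_m) :
  window W -> null_boundary W.
Proof. by case. Qed.

(* In dimension 0 every box has volume 1, so even the empty set has infinite outer measure. *)
Lemma leb_vol_dim0 (R : realType) (A : set 'rV[R]_0) : (1 <= leb_vol A)%E.
Proof.
apply: le_ereal_inf_tmp => _ [ab _ <-].
apply: le_trans (nneseries_lim_ge 1 _); last by move=> *; rewrite lee_fin box_vol_ge0.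
by rewrite big_nat1 /box_vol big_ord0.
Qed.

Lemma window_dim_gt0 (R : realType) (m : nat) (W : set 'rV[R]_m) : window W -> (0 < m)%N.
Proof.
case: m W => [|//] W /window_null_boundary W_null.
by have := leb_vol_dim0 (boundary W); rewrite W_null lee_fin ler10.
Qed.

(** * Autocorrelation of model sets *)

Lemma fsbig_widen_setT (T : choiceType) (V : nmodType) (D : set T) (F : T -> V) :
  (forall x, ~ D x -> F x = 0) -> \sum_(x \in [set: T]) F x = \sum_(x \in D) F x.
Proof. by move=> F0; apply/esym/fsbig_widen => // x [_ /F0]. Qed.

Lemma fsbig_indicator (T : choiceType) (V : nmodType) (A S : set T) (v : V) :
  finite_set A -> \sum_(x \in A) (if x \in S then v else 0) = v *+ set_card (A `&` S).
Proof.
move=> fA; rewrite -fsbig_mkcondr fsbig_finite; last exact: finite_setIl.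
exact: sumr_const_set_card.
Qed.

Lemma sum_differences (G : zmodType) (V : nmodType) (A : set G) (F : G -> V) :
  finite_set A ->
  \sum_(z \in A) \sum_(z' \in A) F (z - z') =
  \sum_(w \in [set: G]) F w *+ set_card (A `&` [set z | A (z - w)]).
Proof.
move=> fA; pose D : set G := [set z - z' | z in A & z' in A].
have fD : finite_set D by exact: finite_image2.
have inner_sum z : A z ->
    \sum_(z' \in A) F (z - z') = \sum_(w \in D) (if w \in [set w | A (z - w)] then F w else 0).
  move=> Az; rewrite -fsbig_mkcondr (_ : D `&` _ = [set w | A (z - w)]); last first.
    apply/seteqP; split=> [w []//|w Azw]; split=> //.
    by exists z => //; exists (z - w); rewrite ?subKr.
  rewrite (@reindex_fsbig _ _ _ _ _ (fun w => z - w) [set w | A (z - w)] A).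
    by apply: eq_fsbigr => w _; rewrite subKr.
  by split=> [w //|w w' _ _ /addrI/oppr_inj //|w Aw]; exists (z - w) => /=; rewrite ?subKr.
rewrite (fsbig_widen_setT (D := D)) => [|w nDw]; last first.
  rewrite (_ : A `&` _ = set0) ?/set_card ?fset_set0 // -subset0 => z [Az Azw].
  by apply: nDw; exists z => //; exists (z - w); rewrite ?subKr.
under eq_fsbigr => z Az do rewrite (inner_sum z (set_mem Az)).
rewrite exchange_fsbig //; apply: eq_fsbigr => w _.
by rewrite -fsbig_indicator //; apply: eq_fsbigr => z _;
  congr (if _ then _ else _); apply/idP/idP => /set_mem ?; apply/mem_set.
Qed.

Section Autocorrelation.
Variables (R : realType) (n m : nat) (B : 'M[R]_(n + m)).
Hypotheses (n_gt0 : (0 < n)%N) (m_gt0 : (0 < m)%N) (B_cps : cut_project_scheme B).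
Local Notation direct := (direct B).
Local Notation internal := (internal B).

Lemma direct_inj : injective direct.
Proof.
have [B_unit inj _] := B_cps; move=> z w /inj zw; apply: (embed_inj B_unit).
by apply: zw; [exists z|exists w].
Qed.

Variables (W : set 'rV[R]_m) (t : 'rV[R]_n).
Hypotheses (W_compact : compact W) (W_null : null_boundary W).

Let in_ball r := lattice_points B [set x | eball r (t + x)] W.

Let model_set_eball r : model_set B t W `&` @eball R n r = [set t + direct z | z in in_ball r].
Proof.
apply/seteqP; split=> [_ [[_ [[z _ <-] Wz] <-] zr]|_ [z [zr Wz] <-]]; first by exists z.
by split=> //; exists (embed B z) => //; split=> //; exists z.
Qed.

Let opp_model_set_eball r :
  [set - x | x in model_set B t W] `&` @eball R n r = [set - (t + direct z) | z in in_ball r].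
Proof.
have eballN x : @eball R n r (- x) = eball r x.
  by rewrite /eball /= -/(enorm (- x)) -/(enorm x) enormN.
apply/seteqP; split=> [_ [[x Lx <-]]|_ [z zr <-]].
  rewrite eballN => xr; have : (model_set B t W `&` eball r) x by [].
  by rewrite model_set_eball => -[z zr <-]; exists z.
have : [set t + direct z | z in in_ball r] (t + direct z) by exists z.
by rewrite -model_set_eball => -[Lz zr']; split; [exists (t + direct z)|rewrite eballN].
Qed.

Let finite_in_ball r : finite_set (in_ball r).
Proof.
have [B_unit _ _] := B_cps; apply: finite_lattice_points => //; last exact: compact_bounded.
have /bounded_setP[M M0 rM] := @bounded_eball R n r.
apply/bounded_setP; exists (M + `|t|); first by rewrite ltr_pwDl.
by move=> x /rM xM; rewrite -(addKr t x) addrC (le_trans (ler_normB _ _)) // lerD.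
Qed.

Definition ball_pairs u r : set 'rV[R]_n := [set x | eball r (t + x) /\ eball r (t + (x - u))].

Lemma van_hove_ball_pairs u : van_hove (ball_pairs u) (fun r => vol (@eball R n r)).
Proof.
pose D := enorm t + enorm (t - u).
have tD : enorm t <= D by rewrite lerDl enorm_ge0.
have tuD : enorm (t - u) <= D by rewrite lerDr enorm_ge0.
apply: (@van_hove_eball _ _ n_gt0 D); near=> r; split=> x.
  move=> xr; split; rewrite -(subrK D r); apply: eball_sub xr _.
    by rewrite addrK.
  by rewrite addrCA [x + _]addrC addrK.
by move=> [xr _]; apply: eball_sub xr _; rewrite opprD addrCA subrr addr0 enormN.
Unshelve. all: by end_near. Qed.

Lemma autocorr_approxE (f : 'rV[R]_n -> R) r :
  autocorr_approx (model_set B t W) f r =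
  \sum_(w \in [set: 'rV[int]_(n + m)]) f (direct w) *
    ((set_card (lattice_points B (ball_pairs (direct w) r) (overlap W (internal w))))%:R /
     vol (@eball R n r)).
Proof.
rewrite /autocorr_approx model_set_eball opp_model_set_eball.
have shift_inj : injective (fun z => t + direct z) by move=> z w /addrI/direct_inj.
rewrite fsbig_image; last by move=> z w _ _; exact: shift_inj.
under eq_fsbigr => z _.
  rewrite fsbig_image; last by move=> z' w _ _ /oppr_inj/shift_inj.
  under eq_fsbigr => z' _.
    have -> : t + direct z - (t + direct z') = direct (z - z').
      by rewrite raddfB opprD addrACA subrr add0r.
    over.
  over.
rewrite /= (sum_differences (f \o direct) (finite_in_ball r)) mulr_fsuml.
apply: eq_fsbigr => w _.
have -> : in_ball r `&` [set z | in_ball r (z - w)] =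
    lattice_points B (ball_pairs (direct w) r) (overlap W (internal w)).
  apply/seteqP; split=> z.
    move=> [[zr Wz] [zwr Wzw]].
    by split; [split=> //; rewrite -raddfB|apply/overlapP; split=> //; rewrite -raddfB].
  move=> [[zr zwr] /overlapP[Wz Wzw]].
  by do 2 split; rewrite /preimage //= raddfB.
by rewrite /= -[f _ *+ _]mulr_natr -[LHS]mulrA.
Qed.

Definition autocorr_limit (f : 'rV[R]_n -> R) : R :=
  \sum_(w \in [set: 'rV[int]_(n + m)])
    f (direct w) * (density B * vol (overlap W (internal w))).

Theorem autocorr_cvg (f : 'rV[R]_n -> R) : bounded_set [set x | f x != 0] ->
  autocorr_approx (model_set B t W) f r @[r --> +oo] --> autocorr_limit f.
Proof.
have [B_unit _ B_dense] := B_cps; move=> f_bounded.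
pose E := lattice_points B [set x | f x != 0] [set y | overlap W y !=set0].
have fE : finite_set E.
  apply: finite_lattice_points => //.
  by apply: bounded_overlapping => //; exact: compact_bounded.
have off_E w : ~ E w -> f (direct w) = 0 \/ overlap W (internal w) = set0.
  move=> nEw; have [->|fw] := eqVneq (f (direct w)) 0; [by left|right].
  by apply/eqP; apply: contrapT => /negP/set0P Ww; apply: nEw.
rewrite /autocorr_limit (fsbig_widen_setT (D := E)) => [|w /off_E[->|->]]; last 2 first.
- by rewrite mul0r.
- by rewrite /vol leb_vol0 // !mulr0.
under eq_cvg => r.
  rewrite autocorr_approxE (fsbig_widen_setT (D := E)) => [|w /off_E[->|->]]; last 2 first.
  - by rewrite mul0r.
  - by rewrite /lattice_points preimage_set0 setI0 /set_card fset_set0 mul0r mulr0.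
  rewrite fsbig_finite //=.
  over.
rewrite fsbig_finite //=; apply: cvg_big => [|w _]; first exact: add_continuous.
apply: cvgMl_tmp; apply: equidistribution => //; first exact: van_hove_ball_pairs.
exact: jordan_measurable_overlap.
Qed.

End Autocorrelation.

Lemma scheme_dim_gt0 (R : realType) (n m : nat) (B : 'M[R]_(n + m)) :
  cut_project_scheme B -> (0 < m)%N -> (0 < n)%N.
Proof.
case: n B => [|//] B B_cps m0.
have : const_mx 0 = const_mx 1 :> 'rV[int]_(0 + m).
  by apply: (direct_inj B_cps); apply/rowP => -[].
by move=> /rowP/(_ (Ordinal m0)); rewrite !mxE.
Qed.

(** * Homometry *)

Lemma bounded_closed_ball (R : realType) (V : normedModType R) (u : V) (e : R) :
  0 < e -> bounded_set (closed_ball u e).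
Proof.
move=> e0; apply/bounded_setP; exists (`|u| + e); first by rewrite ltr_wpDl.
move=> x; rewrite closed_ballE // /closed_ball_ /= => ux.
by rewrite -(subKr u x) (le_trans (ler_normB _ _)) // lerD2l.
Qed.

Section Bump.
Variables (R : realType) (n : nat).
Implicit Types (u x : 'rV[R]_n) (e : R).

Definition bump u e x : R := Num.max 0 (e - `|x - u|).

Lemma bump_center u e : 0 < e -> bump u e u = e.
Proof. by move=> e0; rewrite /bump subrr normr0 subr0; apply/max_idPr/ltW. Qed.

Lemma bump_far u e x : e <= `|x - u| -> bump u e x = 0.
Proof. by move=> ex; apply/max_idPl; rewrite subr_le0. Qed.

Lemma bump_continuous u e : continuous (bump u e).
Proof.
move=> x; apply: (@continuous_max R _ (fun=> 0) (fun x => e - `|x - u|)).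
  exact: cst_continuous.
apply: (@continuousB _ _ _ (fun=> e) (fun x : 'rV[R]_n => `|x - u|)).
  exact: cst_continuous.
apply: (@continuous_comp _ _ _ (fun x : 'rV[R]_n => x - u) Num.norm).
  by apply: (@continuousB _ _ _ id (fun=> u)); [exact: cvg_id|exact: cst_continuous].
exact: norm_continuous.
Qed.

Lemma Cc_bump u e : 0 < e -> Cc (bump u e).
Proof.
move=> e0; split; first exact: bump_continuous.
have supp_ball : closure [set x | bump u e x != 0] `<=` closed_ball u e.
  apply: closureS => x /= fx; rewrite -ball_normE /= distrC ltNge.
  by apply: contraNN fx => /bump_far->.
apply: bounded_closed_compact; last exact: closed_closure.
exact: sub_bounded_set supp_ball (bounded_closed_ball u e0).
Qed.

End Bump.

Lemma Cc_bounded_support (R : realType) (n : nat) (f : 'rV[R]_n -> R) :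
  Cc f -> bounded_set [set x | f x != 0].
Proof.
by move=> [_ /compact_bounded]; apply: sub_bounded_set; exact: subset_closure.
Qed.

Lemma continuous_dense_eq (R : realType) (T : topologicalType) (f g : T -> R) (D : set T) :
  continuous f -> continuous g -> dense D -> (forall x, D x -> f x = g x) -> f =1 g.
Proof.
move=> f_cont g_cont D_dense fg x; apply/eqP; rewrite -subr_eq0; apply: contrapT => /negP fgx.
have [||y [fgy Dy]] := @D_dense [set y | f y - g y != 0].
- by exists x.
- apply: (@open_comp _ _ (fun y => f y - g y) [set z | z != 0]) => [y _|].
    by apply: (@continuousB _ _ _ f g); [exact: f_cont|exact: g_cont].
  exact: open_neq.
- by move: fgy; rewrite /= fg // subrr eqxx.
Qed.

Lemma homometricP (R : realType) (n : nat) (X X' : set 'rV[R]_n) (L L' : ('rV[R]_n -> R) -> R) :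
  (forall f, Cc f -> autocorr_approx X f r @[r --> +oo] --> L f) ->
  (forall f, Cc f -> autocorr_approx X' f r @[r --> +oo] --> L' f) ->
  homometric X X' <-> forall f, Cc f -> L f = L' f.
Proof.
move=> XL XL'; split=> [[gamma limits] f f_Cc|LL'].
  have [Xg Xg'] := limits f f_Cc.
  by rewrite -(cvg_unique _ Xg (XL f f_Cc)) // -(cvg_unique _ Xg' (XL' f f_Cc)).
by exists L => f f_Cc; split; [exact: XL|rewrite LL' //; exact: XL'].
Qed.

Section Homometry.
Variables (R : realType) (n m : nat) (B : 'M[R]_(n + m)).
Hypotheses (n_gt0 : (0 < n)%N) (m_gt0 : (0 < m)%N) (B_cps : cut_project_scheme B).

Lemma isolating_bump (A : set 'rV[R]_m) w0 : bounded_set A ->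
  exists f, [/\ Cc f, f (direct B w0) != 0 &
    forall w, A (internal B w) -> w != w0 -> f (direct B w) = 0].
Proof.
have [B_unit _ _] := B_cps; move=> bA; set u := direct B w0.
pose P := direct B @` (lattice_points B (ball u 1) A `\ w0).
have fP : finite_set P.
  apply/finite_image/finite_setD/finite_lattice_points => //.
  exact: sub_bounded_set (@subset_closed_ball _ _ u 1) (bounded_closed_ball u ltr01).
have P_closed : closed P.
  by apply: (accessible_finite_set_closed.1 _ _ fP); apply/hausdorff_accessible/norm_hausdorff.
have nPu : ~ P u by move=> [w [_ ww0] /(direct_inj B_cps)].
have /nbhs_ballP[d /= d0 ball_nP] : nbhs u (~` P).
  by apply: open_nbhs_nbhs; split=> //; exact: closed_openC.
pose e := Num.min d 1; have e0 : 0 < e by rewrite lt_min d0 ltr01.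
exists (bump u e); split; [exact: Cc_bump|by rewrite bump_center ?gt_eqF|move=> w Aw ww0].
apply: bump_far; rewrite leNgt; apply/negP; rewrite lt_min => /andP[wd w1].
have ball_w c : `|direct B w - u| < c -> ball u c (direct B w).
  by rewrite -ball_normE /= distrC.
apply: (ball_nP (direct B w)); first exact: ball_w.
by exists w => //; split; [split=> //; exact: ball_w|exact/eqP].
Qed.

Variables (W W' : set 'rV[R]_m).
Hypotheses (W_compact : compact W) (W'_compact : compact W').
Hypotheses (W_null : null_boundary W) (W'_null : null_boundary W').

Lemma autocorr_limit_isolated (A V : set 'rV[R]_m) (f : 'rV[R]_n -> R) w0 :
  [set y | overlap V y !=set0] `<=` A ->
  (forall w, A (internal B w) -> w != w0 -> f (direct B w) = 0) ->
  autocorr_limit B V f = f (direct B w0) * (density B * vol (overlap V (internal B w0))).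
Proof.
move=> VA f_isol; rewrite /autocorr_limit (fsbig_widen_setT (D := [set w0])) ?fsbig_set1 //.
move=> w ww0; have [->|/set0P V_w] := eqVneq (overlap V (internal B w)) set0.
  by rewrite /vol leb_vol0 // !mulr0.
by rewrite f_isol ?mul0r //; [exact: VA|exact/eqP].
Qed.

Lemma autocorr_limit_determines_overlap :
  (forall f, Cc f -> autocorr_limit B W f = autocorr_limit B W' f) ->
  forall y, vol (overlap W y) = vol (overlap W' y).
Proof.
have [B_unit _ B_dense] := B_cps; move=> eq_limits.
apply: (continuous_dense_eq _ _ B_dense) => [||_ [_ [w _ <-] <-]].
- exact: vol_overlap_continuous.
- exact: vol_overlap_continuous.
pose A := [set y | overlap W y !=set0] `|` [set y | overlap W' y !=set0].
have bA : bounded_set A.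
  by apply: bounded_setU; apply: bounded_overlapping; exact: compact_bounded.
have [f [f_Cc fw_neq0 f_isol]] := isolating_bump w bA.
have := eq_limits f f_Cc.
rewrite (@autocorr_limit_isolated A W f w _ f_isol); last exact: subsetUl.
rewrite (@autocorr_limit_isolated A W' f w _ f_isol); last exact: subsetUr.
by move=> /(mulfI fw_neq0)/mulfI; apply; rewrite gt_eqF // density_gt0.
Qed.

End Homometry.

Theorem theorem1 (R : realType) (n m : nat) (B : 'M[R]_(n + m))
  (hB : cut_project_scheme B)
  (W W' : set 'rV[R]_m) (hW : window W) (hW' : window W')
  (t t' : 'rV[R]_n) :
  homometric (model_set B t W) (model_set B t' W') <->
  (forall y : 'rV[R]_m, covariogram W y = covariogram W' y).
Proof.
have m_gt0 := window_dim_gt0 hW; have n_gt0 := scheme_dim_gt0 hB m_gt0.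
have [W_compact W_null] := (window_compact hW, window_null_boundary hW).
have [W'_compact W'_null] := (window_compact hW', window_null_boundary hW').
have limit V s : compact V -> null_boundary V -> forall f, Cc f ->
    autocorr_approx (model_set B s V) f r @[r --> +oo] --> autocorr_limit B V f.
  by move=> V_compact V_null f /Cc_bounded_support; exact: autocorr_cvg.
have -> := homometricP (limit W t W_compact W_null) (limit W' t' W'_compact W'_null).
split=> [eq_limits y|eq_covariograms f _].
  rewrite !covariogramE //; congr EFin.
  exact: (autocorr_limit_determines_overlap n_gt0 m_gt0 hB).
by apply: eq_fsbigr => w _; rewrite /vol -!/(covariogram _ _) eq_covariograms.
Qed.
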